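(* There is an algorithm that, given an EDT0L presentation for a marked group $(G,S)$, produces a finite presentation, in the category of residually free groups, of the residually free image of $(G,S)$. That is, it outputs a finite set $R\subseteq\mathbb{F}_S$ such that, as marked groups, $$\big((\mathbb{F}_S/\langle\langle R\rangle\rangle)/\kappa(\mathbb{F}_S/\langle\langle R\rangle\rangle),S\big)=(G/\kappa(G),S).$$
   Context: For a group $G$, $\kappa(G)$ denotes the intersection of the kernels of all homomorphisms from $G$ to free groups; $G/\kappa(G)$, marked by the image of the generating tuple $S$ of $G$, is the residually free image of $(G,S)$. $\mathbb{F}_S$ is the free group on $S$ and $\langle\langle R\rangle\rangle$ the normal closure of $R$. A marked group is a group together with a finite generating tuple; equality of marked groups means that the correspondence of generating tuples extends to a group isomorphism. All alphabets are finite. An EDT0L language over an alphabet $A$ is one of the form $A^*\cap\bigcup_{n\ge 0}\Phi^n(w_0)$, where $A_E$ is a finite alphabet disjoint from $A$, $w_0\in (A\cup A_E)^*$, $\Phi$ is a finite set of monoid endomorphisms of $(A\cup A_E)^*$, and $\Phi^n(w_0)$ is the set of images of $w_0$ under all compositions of $n$ elements of $\Phi$. The finite data $(A,A_E,w_0,\Phi)$ is an EDT0L system describing the language. An EDT0L presentation of a marked group $(G,S)$ consists of the finite tuple $S$ and an EDT0L system describing a language $L\subseteq(S\cup S^{-1})^*$ over $S\cup S^{-1}$ with $G=\mathbb{F}_S/\langle\langle L\rangle\rangle$. *)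

(* Defs.v *)
From HB Require Import structures.
From mathcomp Require Import all_boot.
From mathcomp Require Import boolp classical_sets.

Set Implicit Arguments.
Unset Strict Implicit.
Unset Printing Implicit Defensive.

Local Open Scope group_scope.

(* Signed letters: (x, false) stands for x and (x, true) for x^-1. *)
Notation signed X := (X * bool)%type.

Definition letter_inv (X : Type) (a : signed X) : signed X := (a.1, ~~ a.2).

Definition reduced (X : eqType) (w : seq (signed X)) : bool :=
  sorted (fun a b => b != letter_inv a) w.

(* Left multiplication of a reduced word by a letter. *)
Definition push (X : eqType) (a : signed X) (w : seq (signed X)) :
    seq (signed X) :=
  if w is b :: w' then if b == letter_inv a then w' else a :: w else [:: a].

Record free (X : choiceType) : Type := Free {
  free_word : seq (signed X);
  free_wordP : reduced free_word
}.
HB.instance Definition _ (X : choiceType) := [isSub for @free_word X].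
HB.instance Definition _ (X : choiceType) := [Choice of free X by <:].

Section FreeGroup.
Variable X : choiceType.
Implicit Types (a b : signed X) (u v w : seq (signed X)) (x y z : free X).

Lemma letter_invK : involutive (@letter_inv X).
Proof. by case=> x e; rewrite /letter_inv /= negbK. Qed.

Lemma reduced_push a w : reduced w -> reduced (push a w).
Proof.
case: w => [|b w] //= bw; case: ifPn => [_|ba]; last by rewrite /= ba.
by case: w bw => [|c w] //= /andP[].
Qed.

Lemma pushK a w : reduced w -> push (letter_inv a) (push a w) = w.
Proof.
case: w => [|b w] /= bw; first by rewrite letter_invK eqxx.
case: ifPn => [/eqP eb|_] /=; last by rewrite letter_invK eqxx.
subst b; case: w bw => [|c w] //= /andP[].
by move=> /negbTE -> _.
Qed.

Lemma reduced_foldr u w : reduced w -> reduced (foldr (@push X) w u).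
Proof. by move=> rw; elim: u => //= a u; apply: reduced_push. Qed.

Lemma foldr_push a u w : reduced w ->
  foldr (@push X) w (push a u) = push a (foldr (@push X) w u).
Proof.
move=> rw; case: u => [|b u] //=; case: ifPn => [/eqP eb|//].
subst b; rewrite /= -[X in push X (push _ _)]letter_invK pushK //.
exact: reduced_foldr.
Qed.

Lemma foldr_foldr u v w : reduced w ->
  foldr (@push X) w (foldr (@push X) v u) =
  foldr (@push X) (foldr (@push X) w v) u.
Proof. by move=> rw; elim: u => //= a u IHu; rewrite foldr_push // IHu. Qed.

Lemma foldr_nil w : reduced w -> foldr (@push X) [::] w = w.
Proof.
elim: w => // a [|b w] IHw //= /andP[ba bw].
by have /= -> := IHw bw; rewrite /= (negbTE ba).
Qed.

Lemma reduced_inv w : reduced w -> reduced (rev (map (@letter_inv X) w)).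
Proof.
rewrite /reduced rev_sorted sorted_map.
apply: sub_sorted => a b /=; apply: contraNneq => ->.
by rewrite letter_invK.
Qed.

Lemma foldr_inv u w : reduced w ->
  foldr (@push X) (foldr (@push X) w u) (rev (map (@letter_inv X) u)) = w.
Proof.
move=> rw; elim: u => //= a u IHu.
by rewrite rev_cons -cats1 foldr_cat /= pushK ?reduced_foldr.
Qed.

Lemma inv_invw w :
  rev (map (@letter_inv X) (rev (map (@letter_inv X) w))) = w.
Proof.
by rewrite -map_rev revK -map_comp map_id_in // => a _; apply: letter_invK.
Qed.

Definition free_one : free X := @Free X [::] isT.
Definition free_mul x y : free X :=
  Free (reduced_foldr (free_word x) (free_wordP y)).
Definition free_inv x : free X := Free (reduced_inv (free_wordP x)).

Lemma free_mulA : associative free_mul.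
Proof. by move=> x y z; apply: val_inj; rewrite /= foldr_foldr ?free_wordP. Qed.
Lemma free_mul1 : left_id free_one free_mul.
Proof. by move=> x; apply: val_inj. Qed.
Lemma free_mulr1 : right_id free_one free_mul.
Proof. by move=> x; apply: val_inj; rewrite /= foldr_nil ?free_wordP. Qed.
Lemma free_mulV : left_inverse free_one free_inv free_mul.
Proof.
move=> x; apply: val_inj => /=.
by rewrite -[X in foldr _ X _]foldr_nil ?free_wordP // foldr_inv.
Qed.
Lemma free_mulrV : right_inverse free_one free_inv free_mul.
Proof.
by move=> x; rewrite -[RHS](free_mulV (free_inv x)); congr free_mul;
   apply: val_inj; rewrite /= inv_invw.
Qed.

HB.instance Definition _ := isGroup.Build (free X)
  free_mulA free_mul1 free_mulr1 free_mulV free_mulrV.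

Definition free_gen (t : X) : free X := @Free X [:: (t, false)] isT.

End FreeGroup.

(* The element of G represented by a word over X and X^-1. *)
Definition word_val (X : Type) (G : groupType) (g : X -> G)
    (w : seq (signed X)) : G :=
  \prod_(a <- w) (if a.2 then (g a.1)^-1 else g a.1).

Definition is_subgroup (G : groupType) (H : set G) : Prop :=
  [/\ H 1, forall x y, H x -> H y -> H (x * y) & forall x, H x -> H x^-1].

Record normal_subgroup (G : groupType) : Type := NormalSubgroup {
  nsub :> G -> Prop;
  nsub_subgroup : is_subgroup nsub;
  nsub_conj : forall x y : G, nsub x -> nsub (x ^ y)
}.

Section Quotient.
Variables (G : groupType) (N : normal_subgroup G).

Definition coset_rel : rel G := fun x y => `[< N (x^-1 * y) >].

Lemma coset_rel_refl : reflexive coset_rel.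
Proof. by move=> x; apply/asboolP; rewrite mulVg; case: (nsub_subgroup N). Qed.
Lemma coset_rel_sym : symmetric coset_rel.
Proof.
have [_ _ NV] := nsub_subgroup N.
by move=> x y; apply/asboolP/asboolP => /NV; rewrite invgM invgK.
Qed.
Lemma coset_rel_trans : transitive coset_rel.
Proof.
have [_ NM _] := nsub_subgroup N.
move=> y x z /asboolP xy /asboolP yz; apply/asboolP.
by have := NM _ _ xy yz; rewrite mulgA -(mulgA x^-1) mulgV mulg1.
Qed.

Canonical coset_equiv := EquivRel coset_rel
  coset_rel_refl coset_rel_sym coset_rel_trans.

Definition quotient : Type := {eq_quot coset_equiv}%qT.
HB.instance Definition _ := Choice.on quotient.

Definition quot_proj (x : G) : quotient := (\pi_({eq_quot coset_equiv}) x)%qT.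
Definition quot_repr (a : quotient) : G :=
  (repr (a : {eq_quot coset_equiv}%qT))%qT.

Lemma quot_reprK a : quot_proj (quot_repr a) = a.
Proof. exact: reprK. Qed.

Lemma quot_projP x y : quot_proj x = quot_proj y <-> N (x^-1 * y).
Proof.
split=> [/(@eqmodP _ coset_equiv)/asboolP //|Nxy].
by apply/(@eqmodP _ coset_equiv)/asboolP.
Qed.

Definition quot_one : quotient := quot_proj 1.
Definition quot_mul (a b : quotient) : quotient :=
  quot_proj (quot_repr a * quot_repr b).
Definition quot_inv (a : quotient) : quotient := quot_proj (quot_repr a)^-1.

Lemma quot_mulE x y : quot_mul (quot_proj x) (quot_proj y) = quot_proj (x * y).
Proof.
have [_ NM _] := nsub_subgroup N.
apply/quot_projP; set x' := quot_repr _; set y' := quot_repr _.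
have Nx : N (x'^-1 * x) by apply/quot_projP; rewrite quot_reprK.
have Ny : N (y'^-1 * y) by apply/quot_projP; rewrite quot_reprK.
have := NM _ _ (nsub_conj y' Nx) Ny.
by rewrite /conjg invgM !mulgA mulgK.
Qed.

Lemma quot_invE x : quot_inv (quot_proj x) = quot_proj x^-1.
Proof.
have [_ _ NV] := nsub_subgroup N.
apply/quot_projP; set x' := quot_repr _; rewrite invgK.
have Nx : N (x'^-1 * x) by apply/quot_projP; rewrite quot_reprK.
have := nsub_conj x'^-1 (NV _ Nx).
have -> : (x'^-1 * x)^-1 ^ x'^-1 = (x' * x^-1); last by [].
by rewrite /conjg invgM !invgK -!mulgA mulgV mulg1.
Qed.

Lemma quot_mulA : associative quot_mul.
Proof.
by move=> a b c; rewrite -(quot_reprK a) -(quot_reprK b) -(quot_reprK c)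
  !quot_mulE mulgA.
Qed.
Lemma quot_mul1 : left_id quot_one quot_mul.
Proof. by move=> a; rewrite -(quot_reprK a) quot_mulE mul1g. Qed.
Lemma quot_mulr1 : right_id quot_one quot_mul.
Proof. by move=> a; rewrite -(quot_reprK a) quot_mulE mulg1. Qed.
Lemma quot_mulV : left_inverse quot_one quot_inv quot_mul.
Proof. by move=> a; rewrite -(quot_reprK a) quot_invE quot_mulE mulVg. Qed.
Lemma quot_mulrV : right_inverse quot_one quot_inv quot_mul.
Proof. by move=> a; rewrite -(quot_reprK a) quot_invE quot_mulE mulgV. Qed.

HB.instance Definition _ := isGroup.Build quotient
  quot_mulA quot_mul1 quot_mulr1 quot_mulV quot_mulrV.

Lemma quot_projM x y : quot_proj (x * y) = quot_proj x * quot_proj y.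
Proof. exact/esym/quot_mulE. Qed.
Lemma quot_proj1 : quot_proj 1 = 1. Proof. by []. Qed.
Lemma quot_projV x : quot_proj x^-1 = (quot_proj x)^-1.
Proof. exact/esym/quot_invE. Qed.

End Quotient.

Definition generates (I : Type) (G : groupType) (g : I -> G) : Prop :=
  forall H : set G, is_subgroup H -> (forall i, H (g i)) -> forall x, H x.

Record marked_group (n : nat) : Type := MarkedGroup {
  mg_group :> groupType;
  mg_gen : 'I_n -> mg_group;
  mg_generates : generates mg_gen
}.

Definition marked_eq (n : nat) (G H : marked_group n) : Prop :=
  exists f : UMagmaMorphism.type G H,
    bijective f /\ forall i, f (mg_gen G i) = mg_gen H i.

Lemma free_generates (X : choiceType) : generates (@free_gen X).
Proof.
move=> H [H1 HM HV] Hg [w rw].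
elim: w rw => [|[x e] w IHw] rw; first by rewrite (_ : Free rw = 1) //; apply: val_inj.
have rw' : reduced w by apply: path_sorted rw.
have -> : Free rw = (if e then (free_gen x)^-1 else free_gen x) * Free rw'.
  apply: val_inj; case: w rw rw' {IHw} => [|b w] rw rw'; case: e rw => //=.
    by rewrite /letter_inv /= => /andP[/negbTE ->].
  by rewrite /letter_inv /= => /andP[/negbTE ->].
by apply: HM => //; case: e {rw} => //; apply: HV.
Qed.

Lemma quot_generates (I : Type) (G : groupType) (N : normal_subgroup G)
  (g : I -> G) : generates g -> generates (fun i => quot_proj N (g i)).
Proof.
move=> gG H [H1 HM HV] Hg a; rewrite -(quot_reprK a).
apply: (gG (fun x => H (quot_proj N x))) => //; split=> //.
  by move=> x y Hx Hy; rewrite quot_projM; apply: HM.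
by move=> x Hx; rewrite quot_projV; apply: HV.
Qed.

Definition free_marked (n : nat) : marked_group n :=
  MarkedGroup (@free_generates 'I_n).

Definition quot_marked (n : nat) (G : marked_group n)
    (N : normal_subgroup G) : marked_group n :=
  MarkedGroup (quot_generates (N := N) (@mg_generates n G)).

Section NormalClosure.
Variables (G : groupType) (R : set G).

Definition nclosure_set : set G :=
  fun x => forall N : normal_subgroup G, (forall r, R r -> N r) -> N x.

Lemma nclosure_subgroup : is_subgroup nclosure_set.
Proof.
split=> [N _|x y Rx Ry N RN|x Rx N RN]; have [N1 NM NV] := nsub_subgroup N => //.
  by apply: NM; [apply: Rx | apply: Ry].
by apply: NV; apply: Rx.
Qed.
Lemma nclosure_conj (x y : G) : nclosure_set x -> nclosure_set (x ^ y).
Proof. by move=> Rx N RN; apply: nsub_conj; apply: Rx. Qed.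

Definition nclosure : normal_subgroup G :=
  NormalSubgroup nclosure_subgroup nclosure_conj.
End NormalClosure.

Section Kappa.
Variable G : groupType.

Definition kappa_set : set G :=
  fun g => forall (X : choiceType) (f : UMagmaMorphism.type G (free X)), f g = 1.

Lemma kappa_subgroup : is_subgroup kappa_set.
Proof.
split=> [X f|x y kx ky X f|x kx X f]; first by rewrite gmulf1.
  by rewrite gmulfM kx ky mulg1.
by rewrite gmulfV kx invg1.
Qed.
Lemma kappa_conj (x y : G) : kappa_set x -> kappa_set (x ^ y).
Proof.
by move=> kx X f; rewrite /conjg !gmulfM gmulfV kx mul1g mulVg.
Qed.

Definition kappa : normal_subgroup G :=
  NormalSubgroup kappa_subgroup kappa_conj.
End Kappa.

Definition residually_free_image (n : nat) (G : marked_group n) :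
  marked_group n := quot_marked (kappa G).

(* F_S / <<W>> for S = 'I_n and a set W of words over S and S^-1. *)
Definition presented (n : nat) (W : set (seq (signed 'I_n))) : marked_group n :=
  @quot_marked n (free_marked n)
    (nclosure [set word_val (@free_gen 'I_n) w | w in W]%classic).

Local Close Scope group_scope.
Local Open Scope nat_scope.

(* An endomorphism of the free monoid on B is given by its values on letters. *)
Notation word_endo B := {ffun B -> seq B}.

Definition endo_app (B : finType) (phi : word_endo B) (w : seq B) : seq B :=
  flatten (map phi w).

(* The disjoint union of the alphabets A and A_E is the type A + A_E. *)
Record edt0l_system (A AE : finType) : Type := EDT0L {
  edt0l_axiom : seq (A + AE)%type;
  edt0l_endos : seq (word_endo (A + AE)%type)
}.

Definition edt0l_iter (A AE : finType) (D : edt0l_system A AE) (n : nat) :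
    set (seq (A + AE)) :=
  fun w => exists phis : seq (word_endo (A + AE)%type),
    [/\ size phis = n,
        {subset phis <= edt0l_endos D}
      & w = foldr (@endo_app (A + AE)%type) (edt0l_axiom D) phis].

Definition edt0l_language (A AE : finType) (D : edt0l_system A AE) :
    set (seq A) :=
  fun w => exists n, edt0l_iter D n (map inl w).

Record edt0l_presentation : Type := EDT0LPresentation {
  pres_rank : nat;
  pres_extra : nat;
  pres_system : edt0l_system (signed 'I_pres_rank) 'I_pres_extra
}.

Definition pres_marked_group (P : edt0l_presentation) :
    marked_group (pres_rank P) :=
  presented (edt0l_language (pres_system P)).

(* Kleene's partial recursive functions. Arguments are read off a list, a
   missing argument being 0. *)
Inductive recfun : Type :=
| RZero
| RSucc
| RProj of nat
| RComp of recfun & seq recfun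
| RPrec of recfun & recfun
| RMin of recfun.

(* [computes p s r]: the partial function p is defined at s, with value r. *)
Fixpoint computes (p : recfun) (s : seq nat) (r : nat) {struct p} : Prop :=
  match p with
  | RZero => r = 0
  | RSucc => r = (nth 0 s 0).+1
  | RProj i => r = nth 0 s i
  | RComp f gs => exists t : seq nat,
      (fix all_compute (gs : seq recfun) (t : seq nat) {struct gs} : Prop :=
         match gs, t with
         | [::], [::] => True
         | g :: gs', y :: t' => computes g s y /\ all_compute gs' t'
         | _, _ => False
         end) gs t /\ computes f t r
  | RPrec f g => exists h : nat -> nat,
      [/\ computes f (behead s) (h 0),
          forall k, k < nth 0 s 0 ->
            computes g [:: k, h k & behead s] (h k.+1)
        & r = h (nth 0 s 0)]
  | RMin f =>
      computes f (r :: s) 0 /\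
      forall k, k < r -> exists m, computes f (k :: s) m.+1
  end.

(* Goedel numbers, through the bijection CodeSeq.code from seq nat to nat. *)
Definition enc_seq (T : Type) (e : T -> nat) (s : seq T) : nat :=
  CodeSeq.code (map e s).

Definition enc_signed (n : nat) (a : signed 'I_n) : nat :=
  CodeSeq.code [:: nat_of_ord a.1; nat_of_bool a.2].

Definition enc_letter (n m : nat) (a : signed 'I_n + 'I_m) : nat :=
  match a with
  | inl b => CodeSeq.code [:: 0; enc_signed b]
  | inr j => CodeSeq.code [:: 1; nat_of_ord j]
  end.

(* The table of the pairs (letter, image of that letter). *)
Definition enc_endo (n m : nat)
    (phi : word_endo (signed 'I_n + 'I_m)%type) : nat :=
  enc_seq (fun a => CodeSeq.code [:: enc_letter a; enc_seq (@enc_letter n m) (phi a)])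
    (enum {: signed 'I_n + 'I_m}).

Definition enc_presentation (P : edt0l_presentation) : nat :=
  CodeSeq.code
    [:: pres_rank P; pres_extra P;
        enc_seq (@enc_letter _ _) (edt0l_axiom (pres_system P));
        enc_seq (@enc_endo _ _) (edt0l_endos (pres_system P))].

(* A finite subset of F_S is output as a list of words over S and S^-1. *)
Definition enc_relators (n : nat) (R : seq (seq (signed 'I_n))) : nat :=
  enc_seq (enc_seq (@enc_signed n)) R.

Definition algorithmic
    (f : forall P : edt0l_presentation, seq (seq (signed 'I_(pres_rank P)))) :
    Prop :=
  exists p : recfun, forall P,
    computes p [:: enc_presentation P] (enc_relators (f P)).

(* Main.v *)
Require Import Defs.
From HB Require Import structures.
From mathcomp Require Import all_boot all_order all_algebra.
From mathcomp Require Import boolp classical_sets.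
From mathcomp Require Import ring zify.

(* Attach to every letter, terminal or not, a generic 2x2 matrix, and to every
   word w the lower left entry P(w) of the product of the matrices of its
   letters. Let W be the set of words obtained from the axiom by at most k
   endomorphisms. If, for every endomorphism phi and every w in W, P(phi(w)) lies
   in the ideal generated by the P(v), v in W, then the common zero set of these
   P(v) is stable under mu |-> mu o phi, so that all P(v), v derived from the
   axiom, vanish on it. Such a k exists by Hilbert's basis theorem, and it is
   found by an unbounded search for the coefficients of the ideal memberships; R
   is the set of terminal words in W.
   A morphism f to a free group gives a point mu: send the letters to the values
   of f, composed with a representation in SL2(Z), and the nonterminals to the
   zero matrix. Then P(w) vanishes at mu if w has a nonterminal or f(w) = 1, and
   conversely, given u = f(w) <> 1, ping-pong provides a representation in
   which the lower left entry of u is nonzero. *)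

Set Implicit Arguments.
Unset Strict Implicit.
Unset Printing Implicit Defensive.

Import Order.TTheory GRing.Theory Num.Theory.

(** * Computable functions on encoded data *)

Arguments computes : simpl never.

Lemma computes_comp1 f g s y r :
  computes g s y -> computes f [:: y] r -> computes (RComp f [:: g]) s r.
Proof. by move=> gy fr; exists [:: y]. Qed.

Lemma computes_comp2 f g1 g2 s y1 y2 r :
  computes g1 s y1 -> computes g2 s y2 -> computes f [:: y1; y2] r ->
  computes (RComp f [:: g1; g2]) s r.
Proof. by move=> gy1 gy2 fr; exists [:: y1; y2]. Qed.

Definition rec1 (F : nat -> nat) :=
  exists p, forall a, computes p [:: a] (F a).
Definition rec2 (F : nat -> nat -> nat) :=
  exists p, forall a b, computes p [:: a; b] (F a b).

Lemma rec1_const c : rec1 (fun _ => c).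
Proof.
elim: c => [|c [p Hp]]; first by exists RZero.
by exists (RComp RSucc [:: p]) => a; apply: computes_comp1 (Hp a) _.
Qed.

Lemma rec1_id : rec1 id. Proof. by exists (RProj 0). Qed.

Lemma rec1_comp2 F G H : rec2 F -> rec1 G -> rec1 H ->
  rec1 (fun a => F (G a) (H a)).
Proof.
move=> [p Hp] [q Hq] [r Hr]; exists (RComp p [:: q; r]) => a.
exact: computes_comp2 (Hq a) (Hr a) (Hp _ _).
Qed.

Lemma rec2_comp F G H : rec2 F -> rec2 G -> rec2 H ->
  rec2 (fun a b => F (G a b) (H a b)).
Proof.
move=> [p Hp] [q Hq] [r Hr]; exists (RComp p [:: q; r]) => a b.
exact: computes_comp2 (Hq a b) (Hr a b) (Hp _ _).
Qed.

Lemma rec2_comp1 F G : rec1 F -> rec2 G -> rec2 (fun a b => F (G a b)).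
Proof.
move=> [p Hp] [q Hq]; exists (RComp p [:: q]) => a b.
exact: computes_comp1 (Hq a b) (Hp _).
Qed.

Lemma rec2_fst : rec2 (fun a _ => a). Proof. by exists (RProj 0). Qed.
Lemma rec2_snd : rec2 (fun _ b => b). Proof. by exists (RProj 1). Qed.

Lemma rec2_iter F : rec1 F -> rec2 (fun n b => iter n F b).
Proof.
move=> [p Hp]; exists (RPrec (RProj 0) (RComp p [:: RProj 1])) => n b.
exists (fun k => iter k F b); split=> //= k _.
exact: (@computes_comp1 _ _ [:: k; iter k F b; b] (iter k F b)).
Qed.

Lemma rec2_iter2 F c : rec2 F -> rec2 (fun n b => iter n (F b) c).
Proof.
move=> [p Hp]; have [q Hq] := rec1_const c.
exists (RPrec q (RComp p [:: RProj 2; RProj 1])) => n b.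
exists (fun k => iter k (F b) c); split=> //= k _.
exact: (@computes_comp2 _ _ _ [:: k; iter k (F b) c; b] b (iter k (F b) c)).
Qed.

Lemma rec1_succ : rec1 S. Proof. by exists RSucc. Qed.

Lemma rec2_add : rec2 addn.
Proof.
have [p Hp] := rec2_iter rec1_succ; exists p => a b.
by have := Hp a b; rewrite iter_succn addnC.
Qed.

Lemma rec2_mul : rec2 muln.
Proof.
have [p Hp] := rec2_iter2 0 rec2_add; exists p => a b.
by have := Hp a b; rewrite iter_addn_0 mulnC.
Qed.

Lemma rec1_pow : rec1 (expn 2).
Proof.
have [p Hp] := rec1_comp2 (rec2_iter2 1 rec2_mul) rec1_id (rec1_const 2).
by exists p => a; have := Hp a; rewrite iter_muln_1.
Qed.

Lemma rec1_pred : rec1 predn.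
Proof.
exists (RPrec RZero (RProj 0)) => a; exists predn.
by split.
Qed.

Lemma rec2_sub : rec2 subn.
Proof.
have [p Hp] := rec2_comp (rec2_iter rec1_pred) rec2_snd rec2_fst.
by exists p => a b; have := Hp a b; rewrite iter_predn.
Qed.

(** With truncated subtraction, 1 - ((a - b) + (b - a)) is 1 if a = b and 0 otherwise. *)
Lemma rec2_eq : rec2 (fun a b => a == b).
Proof.
have [p Hp] := rec2_comp rec2_sub (rec2_comp1 (rec1_const 1) rec2_fst)
  (rec2_comp rec2_add rec2_sub (rec2_comp rec2_sub rec2_snd rec2_fst)).
exists p => a b; have := Hp a b; rewrite eqn_leq -!subn_eq0 -addn_eq0.
by case: (_ + _).
Qed.

Lemma rec1_odd : rec1 (fun a => odd a).
Proof.
have sub1 : rec1 (fun a => 1 - a) := rec1_comp2 rec2_sub (rec1_const 1) rec1_id.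
have [p Hp] := rec1_comp2 (rec2_iter sub1) rec1_id (rec1_const 0).
exists p => a; have := Hp a; congr (computes _ _).
by elim: a {Hp} => //= a ->; case: (odd a).
Qed.

Lemma rec1_half : rec1 half.
Proof.
have [p Hp] := rec2_comp rec2_add rec2_snd (rec2_comp1 rec1_odd rec2_fst).
exists (RPrec RZero p) => a; exists half; split=> // k _.
by have := Hp k k./2; rewrite addnC -uphalf_half.
Qed.

(** The code of [a :: s] is 2^a (2c + 1), where c is the code of [s], and the empty list has code 0;
    this formula is applied twice. *)
Lemma rec2_code2 : rec2 (fun a b => CodeSeq.code [:: a; b]).
Proof.
have F2 : rec2 (fun a b => 2 ^ a * (b + b).+1).
  exact: rec2_comp rec2_mul (rec2_comp1 rec1_pow rec2_fst)
    (rec2_comp1 rec1_succ (rec2_comp rec2_add rec2_snd rec2_snd)).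
have [q Hq] := rec2_comp F2 rec2_fst
  (rec2_comp F2 rec2_snd (rec2_comp1 (rec1_const 0) rec2_fst)).
by exists q => a b; have := Hq a b; rewrite !addnn.
Qed.

(** No law is imposed on [enc]. In folds, [default] is the dummy head of an empty list. *)
Class encodable (T : Type) := Encodable { enc : T -> nat; default : T }.

#[export] Instance nat_encodable : encodable nat := Encodable id 0.
#[export] Instance bool_encodable : encodable bool :=
  Encodable nat_of_bool false.
#[export] Instance seq_encodable T {eT : encodable T} : encodable (seq T) :=
  Encodable (enc_seq enc) [::].
#[export] Instance prod_encodable A B {eA : encodable A} {eB : encodable B} :
  encodable (A * B) :=
  Encodable (fun x => CodeSeq.code [:: enc x.1; enc x.2]) (default, default).

(** Nothing is required on numbers that encode no element of [G]; the program may diverge there. *)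
Definition computable {G T} {eG : encodable G} {eT : encodable T}
    (f : G -> T) :=
  exists p, forall x, computes p [:: enc x] (enc (f x)).

Section Computable.
Context {G : Type} {eG : encodable G}.

Lemma computable_eq {T} {eT : encodable T} (f f' : G -> T) :
  f =1 f' -> computable f -> computable f'.
Proof. by move=> ff' [p Hp]; exists p => x; rewrite -ff'. Qed.

(** Only the codes of the values matter, which allows changes of type: a truth value becomes 0 or 1,
    a pair becomes a list of two codes. *)
Lemma computable_recode {T T'} {eT : encodable T} {eT' : encodable T'}
    (f : G -> T) (f' : G -> T') :
  (forall x, enc (f x) = enc (f' x)) -> computable f -> computable f'.
Proof. by move=> ff' [p Hp]; exists p => x; rewrite -ff'. Qed.

Lemma computable_id : computable (fun x : G => x).
Proof. by exists (RProj 0). Qed.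

Lemma computable_const {T} {eT : encodable T} (c : T) :
  computable (fun _ : G => c).
Proof. by have [p Hp] := rec1_const (enc c); exists p => x; apply: Hp. Qed.

Lemma computable_comp {A T} {eA : encodable A} {eT : encodable T}
    (f : A -> T) (g : G -> A) :
  computable f -> computable g -> computable (fun x => f (g x)).
Proof.
move=> [p Hp] [q Hq]; exists (RComp p [:: q]) => x.
exact: computes_comp1 (Hq x) (Hp _).
Qed.

Lemma computable_rec1 F (a : G -> nat) :
  rec1 F -> computable a -> computable (fun x => F (a x)).
Proof.
move=> [p Hp] [q Hq]; exists (RComp p [:: q]) => x.
exact: computes_comp1 (Hq x) (Hp _).
Qed.

Lemma computable_rec2 F (a b : G -> nat) :
  rec2 F -> computable a -> computable b -> computable (fun x => F (a x) (b x)).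
Proof.
move=> [p Hp] [q Hq] [r Hr]; exists (RComp p [:: q; r]) => x.
exact: computes_comp2 (Hq x) (Hr x) (Hp _ _).
Qed.

Lemma computable_enc {T} {eT : encodable T} (f : G -> T) :
  computable f -> computable (fun x => enc (f x)).
Proof. exact: computable_recode. Qed.

Lemma computable_add (a b : G -> nat) :
  computable a -> computable b -> computable (fun x => a x + b x).
Proof. exact: (computable_rec2 rec2_add). Qed.
Lemma computable_mul (a b : G -> nat) :
  computable a -> computable b -> computable (fun x => a x * b x).
Proof. exact: (computable_rec2 rec2_mul). Qed.
Lemma computable_succ (a : G -> nat) :
  computable a -> computable (fun x => (a x).+1).
Proof. exact: (computable_rec1 rec1_succ). Qed.

Lemma computable_eqn (a b : G -> nat) :
  computable a -> computable b -> computable (fun x => a x == b x).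
Proof.
move=> ca cb; apply: (computable_recode _ (computable_rec2 rec2_eq ca cb)).
by [].
Qed.

Lemma computable_neg (a : G -> bool) :
  computable a -> computable (fun x => ~~ a x).
Proof.
move=> /computable_enc ca.
apply: computable_eq (computable_eqn ca (computable_const 0)).
by move=> x; rewrite /enc /=; case: (a x).
Qed.

Lemma computable_and (a b : G -> bool) :
  computable a -> computable b -> computable (fun x => a x && b x).
Proof.
move=> /computable_enc ca /computable_enc cb.
apply: computable_recode (computable_mul ca cb).
by move=> x; rewrite /enc /= mulnb.
Qed.

(** On codes, the conditional is b f + (1 - b) g, with b equal to 0 or 1. *)
Lemma computable_if {T} {eT : encodable T} (b : G -> bool) (f g : G -> T) :
  computable b -> computable f -> computable g ->
  computable (fun x => if b x then f x else g x).
Proof.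
move=> cb /computable_enc cf /computable_enc cg.
have /computable_enc cb' := computable_neg cb.
move: cb => /computable_enc cb.
apply: computable_recode (computable_add (computable_mul cb cf)
  (computable_mul cb' cg)).
by move=> x; case: (b x); rewrite /= ?mul1n ?mul0n ?addn0.
Qed.

Lemma computable_cons {T} {eT : encodable T} (a : G -> T) (l : G -> seq T) :
  computable a -> computable l -> computable (fun x => a x :: l x).
Proof.
move=> /computable_enc ca /computable_enc cl.
apply: computable_recode (computable_mul (computable_rec1 rec1_pow ca)
  (computable_succ (computable_add cl cl))).
by move=> x; rewrite /enc /= /enc_seq /= addnn.
Qed.

Lemma computable_pair {A B} {eA : encodable A} {eB : encodable B}
    (a : G -> A) (b : G -> B) :
  computable a -> computable b -> computable (fun x => (a x, b x)).
Proof.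
move=> /computable_enc ca /computable_enc cb.
apply: computable_recode (computable_cons ca (computable_cons cb
  (computable_const [::]))).
by [].
Qed.

End Computable.

(** * Decoding of lists, iteration and folds *)

Lemma code_cons0 s : CodeSeq.code (0 :: s) = (CodeSeq.code s).*2.+1.
Proof. exact: mul1n. Qed.

Lemma code_consS a s : CodeSeq.code (a.+1 :: s) = (CodeSeq.code (a :: s)).*2.
Proof. by rewrite /= expnS -mulnA mul2n. Qed.

Lemma code_eq0 s : (CodeSeq.code s == 0) = nilp s.
Proof. by case: s => //= a s; rewrite muln_eq0 expn_eq0. Qed.

(* The head of a list is the 2-adic valuation of its code; the search would
   diverge on the code 0 of the empty list, which is first replaced by 1. *)
Lemma computes_head :
  exists p, forall s, computes p [:: CodeSeq.code s] (head 0 s).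
Proof.
have [p Hp] := rec2_comp rec2_sub (rec2_comp1 (rec1_const 1) rec2_fst)
  (rec2_comp1 rec1_odd (rec2_iter rec1_half)).
have [q Hq] := rec1_comp2 rec2_add rec1_id
  (rec1_comp2 rec2_eq rec1_id (rec1_const 0)).
exists (RComp (RMin p) [:: q]) => -[|a s].
  by apply: (computes_comp1 (Hq 0)); split=> //; apply: (Hp 0 1).
have iter_code k : k <= a ->
    iter k half (CodeSeq.code (a :: s)) = CodeSeq.code (a - k :: s).
  elim: k => [|k IHk] ka; first by rewrite subn0.
  by rewrite iterS IHk ?(ltnW ka) // -(subnSK ka) code_consS doubleK.
have := Hq (CodeSeq.code (a :: s)).
rewrite code_eq0 addn0 => /computes_comp1; apply; split=> [|k ka].
  have := Hp a (CodeSeq.code (a :: s)).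
  by rewrite iter_code // subnn code_cons0 oddS odd_double.
exists 0; have := Hp k (CodeSeq.code (a :: s)).
by rewrite iter_code ?(ltnW ka) // -(subnSK ka) code_consS odd_double.
Qed.

(** Halving a times turns 2^a (2c + 1) into 2c + 1, and one more halving leaves c. The code 0 of the
    empty list is unchanged. *)
Lemma computes_behead :
  exists p, forall s, computes p [:: CodeSeq.code s] (CodeSeq.code (behead s)).
Proof.
have [p Hp] := computes_head; have [q Hq] := rec2_iter rec1_half.
exists (RComp q [:: RComp RSucc [:: p]; RProj 0]) => s.
apply: (@computes_comp2 _ _ _ _ (head 0 s).+1 (CodeSeq.code s)) => //.
  exact: computes_comp1 (Hp s) _.
have -> : CodeSeq.code (behead s) = iter (head 0 s).+1 half (CodeSeq.code s).
  case: s => [|a s] //; rewrite [head _ _]/= [behead _]/=.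
  elim: a => [|a ->]; first by rewrite code_cons0 /= uphalf_double.
  by rewrite [in RHS]iterSr code_consS doubleK.
exact: Hq.
Qed.

Section ComputableSeq.
Context {G : Type} {eG : encodable G}.
Context {A : Type} {eA : encodable A}.

Lemma computable_fst {B} {eB : encodable B} (f : G -> A * B) :
  computable f -> computable (fun x => (f x).1).
Proof.
move=> cf; have cp : computable (fun y : A * B => y.1).
  have [p Hp] := computes_head.
  by exists p => y; exact: (Hp [:: enc y.1; enc y.2]).
exact: computable_comp.
Qed.

Lemma computable_snd {B} {eB : encodable B} (f : G -> B * A) :
  computable f -> computable (fun x => (f x).2).
Proof.
move=> cf; have cp : computable (fun y : B * A => y.2); last exact: computable_comp.
have [p Hp] := computes_head; have [q Hq] := computes_behead.
exists (RComp p [:: q]) => y.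
exact: computes_comp1 (Hq [:: enc y.1; enc y.2]) (Hp _).
Qed.

Lemma computable_behead (l : G -> seq A) :
  computable l -> computable (fun x => behead (l x)).
Proof.
move=> cl; have cp : computable (@behead A); last exact: computable_comp.
have [p Hp] := computes_behead; exists p => -[|a s].
  exact: (Hp [::]).
exact: (Hp (map enc (a :: s))).
Qed.

Lemma computable_nilp (l : G -> seq A) :
  computable l -> computable (fun x => nilp (l x)).
Proof.
move=> /computable_enc cl.
apply: computable_eq (computable_eqn cl (computable_const 0)) => x.
by rewrite /enc /= code_eq0; case: (l x).
Qed.

End ComputableSeq.

Section ComputableIter.
Context {G : Type} {eG : encodable G}.
Context {A : Type} {eA : encodable A}.

Lemma computable_head (d : A) (l : G -> seq A) :
  computable l -> computable (fun x => head d (l x)).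
Proof.
move=> cl; have cp : computable (head d); last exact: computable_comp.
have ch : computable (fun s : seq A => head 0 (map enc s)).
  by have [p Hp] := computes_head; exists p => s; exact: (Hp (map enc s)).
have cd : computable (fun _ : seq A => enc d) by exact: computable_const.
have cif := computable_if (computable_nilp (computable_id (G := seq A))) cd ch.
by apply: (computable_recode (eT := nat_encodable) _ cif); case.
Qed.

Lemma computable_iter (n : G -> nat) (z : G -> A) (f : G -> A -> A) :
  computable n -> computable z ->
  computable (fun x : G * A => f x.1 x.2) ->
  computable (fun x => iter (n x) (f x) (z x)).
Proof.
move=> [pn Hn] [pz Hz] [pf Hf].
have [q Hq] := rec2_code2.
(* The step of [RPrec] receives the counter, the current value and the parameter; the last two are
   repacked as the code of a pair. *)
have Hpp k (a : A) (x : G) :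
    computes (RComp q [:: RProj 2; RProj 1]) [:: k; enc a; enc x] (enc (x, a)).
  by apply: (@computes_comp2 _ _ _ _ (enc x) (enc a)) => //; apply: Hq.
exists (RComp (RPrec pz (RComp pf [:: RComp q [:: RProj 2; RProj 1]]))
  [:: pn; RProj 0]) => x.
apply: (@computes_comp2 _ _ _ _ (n x) (enc x) _ (Hn x)) => //.
exists (fun k => enc (iter k (f x) (z x))); split; first exact: Hz; last by [].
move=> k _; exact: computes_comp1 (Hpp _ _ _) (Hf (x, _)).
Qed.

End ComputableIter.

(** The state is the rest of the list with the accumulator, and it idles once the list is empty, so
    any bound on the length will do as the number of iterations. *)
Lemma iter_foldl A B (f : B -> A -> B) (d : A) n (l : seq A) (z : B) :
  size l <= n ->
  (iter n (fun s : seq A * B => (behead s.1,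
     if nilp s.1 then s.2 else f s.2 (head d s.1))) (l, z)).2 = foldl f z l.
Proof.
elim: n l z => [|n IHn] l z; first by case: l.
by rewrite iterSr; case: l => [|a l] ln; rewrite [X in iter _ _ X]/= IHn.
Qed.

(** This makes the code of a list an admissible number of iterations for a fold over it. *)
Lemma leq_size_enc A {eA : encodable A} (l : seq A) : size l <= enc l.
Proof.
rewrite /enc /= /enc_seq -(size_map enc); elim: (map _ _) => //= a s IHs.
rewrite -[_.+1]mul1n leq_mul ?expn_gt0 // ltnS (leq_trans IHs) //.
by rewrite -addnn leq_addr.
Qed.

Section ComputableFold.
Context {G : Type} {eG : encodable G}.
Context {A : Type} {eA : encodable A} {B : Type} {eB : encodable B}.

Lemma computable_foldl (l : G -> seq A) (z : G -> B) (f : G -> B -> A -> B) :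
  computable (fun x : G * B * A => f x.1.1 x.1.2 x.2) ->
  computable z -> computable l ->
  computable (fun x => foldl (f x) (z x) (l x)).
Proof.
move=> cf cz cl.
apply: (computable_eq (f := fun x => (iter (enc (l x))
  (fun s : seq A * B => (behead s.1,
     if nilp s.1 then s.2 else f x s.2 (head default s.1))) (l x, z x)).2)).
  by move=> x; apply: iter_foldl; apply: leq_size_enc.
have fst2 : computable (fun x : G * (seq A * B) => x.2.1).
  exact: computable_fst (computable_snd computable_id).
have snd2 : computable (fun x : G * (seq A * B) => x.2.2).
  exact: computable_snd (computable_snd computable_id).
apply: computable_snd; apply: computable_iter.
- exact: computable_enc.
- exact: computable_pair.
apply: computable_pair; first exact: computable_behead.
apply: computable_if => //; first exact: computable_nilp.
apply: (computable_comp (f := fun x : G * B * A => f x.1.1 x.1.2 x.2)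
  (g := fun x : G * (seq A * B) => (x.1, x.2.2, head default x.2.1))) => //.
apply: computable_pair; last exact: computable_head.
by apply: computable_pair => //; apply: computable_fst computable_id.
Qed.

End ComputableFold.

Section ComputableList.
Context {G : Type} {eG : encodable G}.
Context {A : Type} {eA : encodable A} {B : Type} {eB : encodable B}.

Lemma computable_rev (l : G -> seq A) :
  computable l -> computable (fun x => rev (l x)).
Proof.
move=> cl; apply: (computable_eq (f := fun x =>
  foldl (fun s a => a :: s) [::] (l x))).
  move=> x; rewrite -[RHS]cats0; elim: (l x) [::] => //= a s IHs t.
  by rewrite IHs rev_cons cat_rcons.
apply: (computable_foldl (f := fun _ s a => a :: s)) cl.
  apply: computable_cons; first exact: computable_snd computable_id.
  exact: computable_snd (computable_fst computable_id).
exact: computable_const.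
Qed.

End ComputableList.

Section ComputableFoldr.
Context {G : Type} {eG : encodable G}.
Context {A : Type} {eA : encodable A} {B : Type} {eB : encodable B}.

Lemma computable_foldr (l : G -> seq A) (z : G -> B) (f : G -> A -> B -> B) :
  computable (fun x : G * A * B => f x.1.1 x.1.2 x.2) ->
  computable z -> computable l ->
  computable (fun x => foldr (f x) (z x) (l x)).
Proof.
move=> cf cz cl; apply: (computable_eq (f := fun x =>
  foldl (fun b a => f x a b) (z x) (rev (l x)))).
  by move=> x; rewrite foldl_rev.
apply: (computable_foldl (f := fun x b a => f x a b)) => //; last first.
  exact: computable_rev.
apply: (computable_comp (f := fun x : G * A * B => f x.1.1 x.1.2 x.2)
  (g := fun x : G * B * A => (x.1.1, x.2, x.1.2))) => //.
apply: computable_pair; last exact: computable_snd (computable_fst computable_id).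
apply: computable_pair; last exact: computable_snd computable_id.
exact: computable_fst (computable_fst computable_id).
Qed.

End ComputableFoldr.

Ltac computable_step :=
  lazymatch goal with
  | |- computable (fun x => x) => exact: computable_id
  | |- computable id => exact: computable_id
  | |- computable fst => exact: (computable_fst computable_id)
  | |- computable snd => exact: (computable_snd computable_id)
  | |- computable (fun x => (_, _)) => apply: computable_pair
  | |- computable (fun x => _ :: _) => apply: computable_cons
  | |- computable (fun x => if _ then _ else _) => apply: computable_if
  | |- computable (fun x => _ && _) => apply: computable_and
  | |- computable (fun x => ~~ _) => apply: computable_neg
  | |- computable (fun x => _ == _) => apply: computable_eqn
  | |- computable (fun x => _ + _) => apply: computable_add
  | |- computable (fun x => _ * _) => apply: computable_mul
  | |- computable (fun x => _.+1) => apply: computable_succ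
  | |- computable (fun x => behead _) => apply: computable_behead
  | |- computable (fun x => nilp _) => apply: computable_nilp
  | |- computable (fun x => head ?d _) => apply: computable_head
  | |- computable (fun x => foldr _ _ _) => apply: computable_foldr; cbv beta
  | |- computable (fun x => iter _ _ _) => apply: computable_iter; cbv beta
  | |- computable (fun x => enc _) => apply: computable_enc
  | |- computable (fun x => _.1) => apply: computable_fst
  | |- computable (fun x => _.2) => apply: computable_snd
  end || exact: computable_const || assumption.

Section ComputableMap.
Context {G : Type} {eG : encodable G}.
Context {A : Type} {eA : encodable A} {B : Type} {eB : encodable B}.

Lemma computable_cat (l r : G -> seq A) :
  computable l -> computable r -> computable (fun x => l x ++ r x).
Proof.
move=> cl cr; apply: (computable_eq (f := fun x => foldr cons (r x) (l x))).
  by move=> x; elim: (l x) => //= a s ->.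
by repeat computable_step.
Qed.

Lemma computable_map (l : G -> seq A) (f : G -> A -> B) :
  computable (fun x : G * A => f x.1 x.2) -> computable l ->
  computable (fun x => map (f x) (l x)).
Proof.
move=> cf cl.
apply: (computable_eq (f := fun x => foldr (fun a s => f x a :: s) [::] (l x))).
  by move=> x; elim: (l x) => //= a s ->.
repeat computable_step.
by apply: (computable_comp cf); repeat computable_step.
Qed.

Lemma computable_filter (l : G -> seq A) (f : G -> pred A) :
  computable (fun x : G * A => f x.1 x.2) -> computable l ->
  computable (fun x => filter (f x) (l x)).
Proof.
move=> cf cl.
apply: (computable_eq (f := fun x =>
  foldr (fun a s => if f x a then a :: s else s) [::] (l x))).
  by move=> x; elim: (l x) => //= a s ->.
repeat computable_step.
by apply: (computable_comp cf); repeat computable_step.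
Qed.

Lemma computable_all (l : G -> seq A) (f : G -> pred A) :
  computable (fun x : G * A => f x.1 x.2) -> computable l ->
  computable (fun x => all (f x) (l x)).
Proof.
move=> cf cl.
apply: (computable_eq (f := fun x =>
  foldr (fun a b => f x a && b) true (l x))).
  by move=> x; elim: (l x) => //= a s ->.
repeat computable_step.
by apply: (computable_comp cf); repeat computable_step.
Qed.

Lemma computable_has (l : G -> seq A) (f : G -> pred A) :
  computable (fun x : G * A => f x.1 x.2) -> computable l ->
  computable (fun x => has (f x) (l x)).
Proof.
move=> cf cl.
apply: (computable_eq (f := fun x => ~~ all (fun a => ~~ f x a) (l x))).
  by move=> x; rewrite -has_predC; apply: eq_has => a; rewrite /= negbK.
by apply: computable_neg; apply: computable_all => //; apply: computable_neg.
Qed.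

Lemma computable_size (l : G -> seq A) :
  computable l -> computable (fun x => size (l x)).
Proof.
move=> cl; apply: (computable_eq (f := fun x =>
  foldr (fun _ n => n.+1) 0 (l x))).
  by move=> x; elim: (l x) => //= a s ->.
by repeat computable_step.
Qed.

Lemma computable_count (l : G -> seq A) (f : G -> pred A) :
  computable (fun x : G * A => f x.1 x.2) -> computable l ->
  computable (fun x => count (f x) (l x)).
Proof.
move=> cf cl.
apply: (computable_eq (f := fun x =>
  foldr (fun a n => f x a + n) 0 (l x))) => //.
repeat computable_step.
apply: (computable_recode (f := fun x : G * A * nat => f x.1.1 x.1.2)) => //.
by apply: (computable_comp cf); repeat computable_step.
Qed.

Lemma computable_nth (d : A) (l : G -> seq A) (n : G -> nat) :
  computable l -> computable n -> computable (fun x => nth d (l x) (n x)).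
Proof.
move=> cl cn.
apply: (computable_eq (f := fun x => head d (iter (n x) behead (l x)))).
  move=> x; elim: (n x) (l x) => [|k IHk] s; first exact: nth0.
  by rewrite iterSr IHk nth_behead.
by repeat computable_step.
Qed.

End ComputableMap.

Lemma computable_flatten {G A} {eG : encodable G} {eA : encodable A}
    (l : G -> seq (seq A)) :
  computable l -> computable (fun x => flatten (l x)).
Proof.
move=> cl; apply: (computable_foldr (f := fun _ s t => s ++ t)) => //.
  by apply: computable_cat; repeat computable_step.
exact: computable_const.
Qed.

Lemma computable_perm_eq {G} {eG : encodable G} (s t : G -> seq nat) :
  computable s -> computable t -> computable (fun x => perm_eq (s x) (t x)).
Proof.
move=> cs ct; rewrite /perm_eq.
have ccount (u : G -> seq nat) : computable u ->
    computable (fun x : G * nat => count_mem x.2 (u x.1)).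
  move=> cu; apply: (computable_count (f := fun x a => a == x.2)).
    by cbv beta; repeat computable_step.
  exact: computable_comp cu (computable_fst computable_id).
apply: computable_all; last exact: computable_cat.
by apply: computable_eqn; apply: ccount.
Qed.

(** Minimisation finds the first zero, hence the negated test; [ex] ensures that all searches
    terminate. The candidate is the first argument under [RMin], hence the swapped pairs. *)
Lemma computable_search {G} {eG : encodable G} (chk : G -> nat -> bool)
    (ex : forall x, exists c, chk x c) :
  computable (fun x : G * nat => chk x.1 x.2) ->
  computable (fun x => ex_minn (ex x)).
Proof.
move=> cc; have [p Hp] : computable (fun x : nat * G => ~~ chk x.2 x.1).
  apply: computable_neg.
  apply: (computable_comp (f := fun x : G * nat => chk x.1 x.2)
    (g := fun x => (x.2, x.1))) => //.
  by repeat computable_step.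
have [q Hq] := rec2_code2.
have chkP x c : computes (RComp p [:: q]) [:: c; enc x] (~~ chk x c).
  exact: computes_comp1 (Hq _ _) (Hp (c, x)).
exists (RMin (RComp p [:: q])) => x; case: ex_minnP => c ch cmin.
split; first by have := chkP x c; rewrite ch.
move=> k kc; exists 0; have := chkP x k.
by have /negbTE -> : ~~ chk x k by apply: contraTN kc => /cmin; rewrite -leqNgt.
Qed.

Ltac computability_step := first
  [ computable_step
  | lazymatch goal with
    | |- computable (fun x => _ ++ _) => apply: computable_cat
    | |- computable (fun x => map _ _) => apply: computable_map; cbv beta
    | |- computable (fun x => flatten _) => apply: computable_flatten
    | |- computable (fun x => filter _ _) => apply: computable_filter; cbv beta
    | |- computable (fun x => all _ _) => apply: computable_all; cbv beta
    | |- computable (fun x => has _ _) => apply: computable_has; cbv beta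
    | |- computable (fun x => count _ _) => apply: computable_count; cbv beta
    | |- computable (fun x => nth _ _ _) => apply: computable_nth
    | |- computable (fun x => size _) => apply: computable_size
    | |- computable (fun x => perm_eq _ _) => apply: computable_perm_eq
    end
  | match goal with H : computable ?f |- computable (fun x => ?f _) =>
      apply: (computable_comp H) end ].

Ltac computability := repeat computability_step.

(** * The search for certificates *)

Notation letter := (nat * nat)%type.
(* A polynomial with coefficients in nat, as the list of its monomials, each of
   them being the list of its variables. *)
Notation natpoly := (seq (seq nat)).

(** Letters are compared through their codes, since equality of numbers is computable; a letter
    missing from the table goes to the empty word. *)
Definition lookup (phi : seq (letter * seq letter)) (b : letter) : seq letter :=
  foldr (fun e s => if enc e.1 == enc b then e.2 else s) [::] phi.

Definition subst phi (w : seq letter) : seq letter :=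
  flatten (map (lookup phi) w).

Definition next_level Phi (W : seq (seq letter)) : seq (seq letter) :=
  flatten (map (fun phi => map (subst phi) W) Phi).

Definition levels Phi w0 n : seq (seq letter) :=
  iter n (fun W => W ++ next_level Phi W) [:: w0].

(** The entry in row i and column j of the matrix of [b] has k = 2i + j. *)
Definition var (b : letter) (k : nat) : nat := enc b * 4 + k.

Definition natpoly_scale (v : nat) (p : natpoly) : natpoly := map (cons v) p.

(** The pair is the first column of a matrix, which the generic matrix of [b] multiplies from the
    left. *)
Definition letter_act (b : letter) (s : natpoly * natpoly) : natpoly * natpoly :=
  (natpoly_scale (var b 0) s.1 ++ natpoly_scale (var b 1) s.2,
   natpoly_scale (var b 2) s.1 ++ natpoly_scale (var b 3) s.2).

(* The lower left entry of the product of the generic 2x2 matrices attached to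
   the letters of a word. *)
Definition word_poly (w : seq letter) : natpoly :=
  (foldr letter_act ([:: [::]], [::]) w).2.

(* A term k :: m stands for the multiple of the polynomial of the k-th word of
   W by the monomial m. *)
Definition combination (W : seq (seq letter)) (C : natpoly) : natpoly :=
  flatten (map (fun t =>
    map (cat (behead t)) (word_poly (nth [::] W (head 0 t)))) C).

(** The coefficient of a monomial is its number of occurrences, up to the order of its variables;
    only monomials occurring in [p] or [q] have to be compared. *)
Definition natpoly_eq (p q : natpoly) : bool :=
  all (fun m => count (perm_eq m) p == count (perm_eq m) q) (p ++ q).

(** Ideal membership over the integers, written without subtraction: the negative part [N] of the
    combination is moved to the side of [t]. Both parts are sought in one common list. *)
Definition certifies (W T : seq (seq letter)) (certs : seq natpoly) : bool :=
  all (fun t => has (fun N => has (fun C =>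
    natpoly_eq (word_poly t ++ combination W N) (combination W C)) certs) certs) T.

(** A first component 0 marks the terminal letters; the second one is then the code of the signed
    generator. *)
Definition terminal_words (W : seq (seq letter)) : seq (seq nat) :=
  map (map snd) (filter (all (fun b => b.1 == 0)) W).

(* As a list of lists of lists of numbers, a certificate can be decoded from
   every number, so that the search ranges over all of nat. *)
Definition decode_certs (c : nat) : seq natpoly :=
  map (fun m => map CodeSeq.decode (CodeSeq.decode m)) (CodeSeq.decode c).

Lemma decode_certsK : cancel enc decode_certs.
Proof.
move=> s; rewrite /enc /= /enc_seq /decode_certs CodeSeq.codeK.
rewrite -map_comp -[RHS]map_id; apply: eq_map => p /=.
rewrite CodeSeq.codeK -map_comp -[RHS]map_id; apply: eq_map => m /=.
by rewrite /enc_seq map_id CodeSeq.codeK.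
Qed.

Lemma enc_decode_certs c : enc (decode_certs c) = c.
Proof.
rewrite /enc /= /enc_seq /decode_certs -map_comp.
rewrite (eq_map (g := id)) ?map_id ?CodeSeq.decodeK // => p /=.
rewrite -map_comp (eq_map (g := id)) ?map_id ?CodeSeq.decodeK // => m /=.
by rewrite map_id CodeSeq.decodeK.
Qed.

(** * Computability of the search *)

Section ComputableAlgorithm.
Context {G : Type} {eG : encodable G}.

Lemma computable_next_level (Phi : G -> seq (seq (letter * seq letter))) W :
  computable Phi -> computable W ->
  computable (fun x => next_level (Phi x) (W x)).
Proof. by rewrite /next_level /subst /lookup => cPhi cW; computability. Qed.

Lemma computable_word_poly (w : G -> seq letter) :
  computable w -> computable (fun x => word_poly (w x)).
Proof.
by rewrite /word_poly /letter_act /natpoly_scale /var => cw; computability.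
Qed.

Lemma computable_natpoly_eq (p q : G -> natpoly) :
  computable p -> computable q -> computable (fun x => natpoly_eq (p x) (q x)).
Proof. by rewrite /natpoly_eq => cp cq; computability. Qed.

Lemma computable_terminal_words (W : G -> seq (seq letter)) :
  computable W -> computable (fun x => terminal_words (W x)).
Proof. by rewrite /terminal_words => cW; computability. Qed.

(** Decoding leaves the code unchanged, so a program for [c] also computes the decoded value. *)
Lemma computable_decode_certs (c : G -> nat) :
  computable c -> computable (fun x => decode_certs (c x)).
Proof.
by apply: computable_recode => x; rewrite enc_decode_certs.
Qed.

End ComputableAlgorithm.

Section ComputableAlgorithm2.
Context {G : Type} {eG : encodable G}.

Lemma computable_levels (Phi : G -> seq (seq (letter * seq letter))) w0 n :
  computable Phi -> computable w0 -> computable n ->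
  computable (fun x => levels (Phi x) (w0 x) (n x)).
Proof.
rewrite /levels => cPhi cw0 cn; computability.
by apply: computable_next_level; computability.
Qed.

Lemma computable_combination (W : G -> seq (seq letter)) (C : G -> natpoly) :
  computable W -> computable C -> computable (fun x => combination (W x) (C x)).
Proof.
rewrite /combination => cW cC; computability.
by apply: computable_word_poly; computability.
Qed.

End ComputableAlgorithm2.

Lemma computable_certifies {G} {eG : encodable G}
    (W T : G -> seq (seq letter)) (certs : G -> seq natpoly) :
  computable W -> computable T -> computable certs ->
  computable (fun x => certifies (W x) (T x) (certs x)).
Proof.
rewrite /certifies => cW cT cC; computability.
apply: computable_natpoly_eq; computability; try apply: computable_word_poly;
  by computability; apply: computable_combination; computability.
Qed.

(** * Hilbert's basis theorem *)

Local Open Scope ring_scope.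

Section Ideals.
Variable R : comNzRingType.
Implicit Types (S T : R -> Prop) (l : seq R).

Inductive ideal S : R -> Prop :=
| Ideal0 : ideal S 0
| IdealD a x y : S x -> ideal S y -> ideal S (a * x + y).

Lemma ideal_gen S x : S x -> ideal S x.
Proof.
by move=> Sx; rewrite -[x]mul1r -[1 * x]addr0; apply: IdealD => //; apply: Ideal0.
Qed.

Lemma ideal_add S x y : ideal S x -> ideal S y -> ideal S (x + y).
Proof.
elim=> [|a z t Sz _ IH] Sy; first by rewrite add0r.
by rewrite -addrA; apply: IdealD => //; apply: IH.
Qed.

Lemma ideal_mul S a x : ideal S x -> ideal S (a * x).
Proof.
elim=> [|b z t Sz _ IH]; first by rewrite mulr0; apply: Ideal0.
by rewrite mulrDr mulrA; apply: IdealD.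
Qed.

Lemma ideal_sub S x y : ideal S x -> ideal S y -> ideal S (x - y).
Proof. by move=> Sx Sy; rewrite -mulN1r; apply/ideal_add/ideal_mul. Qed.

Lemma ideal_trans S T x :
  (forall y, S y -> ideal T y) -> ideal S x -> ideal T x.
Proof.
move=> ST; elim=> [|a y z Sy _ IH]; first exact: Ideal0.
by apply: ideal_add => //; apply/ideal_mul/ST.
Qed.

Lemma ideal_mono S T x : (forall y, S y -> T y) -> ideal S x -> ideal T x.
Proof. by move=> ST; apply: ideal_trans => y /ST /ideal_gen. Qed.

Lemma ideal_finite S x : ideal S x ->
  exists l, (forall y, y \in l -> S y) /\ ideal (fun y => y \in l) x.
Proof.
elim=> [|a y z Sy _ [l [lS lz]]]; first by exists [::]; split=> //; apply: Ideal0.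
exists (y :: l); split=> [t|].
  by rewrite inE => /orP[/eqP -> //|/lS].
apply: IdealD; first by rewrite inE eqxx.
by apply: ideal_mono lz => t tl; rewrite inE tl orbT.
Qed.

(** The finitely many generators are taken from [S] itself: in the application they have to be
    polynomials of derived words. *)
Definition noetherian : Prop := forall S, exists l,
  (forall x, x \in l -> S x) /\ forall x, S x -> ideal (fun y => y \in l) x.

(** Generators in the ideal can be traded for generators in [S], because each of them is a
    combination of finitely many elements of [S]. *)
Lemma noetherian_ideal :
  (forall S, exists l, (forall x, x \in l -> ideal S x) /\
    forall x, S x -> ideal (fun y => y \in l) x) ->
  noetherian.
Proof.
move=> HR S; have [l [lS Sl]] := HR S.
have [l' [l'S ll']] : exists l', (forall x, x \in l' -> S x) /\
    forall x, x \in l -> ideal (fun y => y \in l') x.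
  elim: l lS {Sl} => [|a l IHl] lS; first by exists [::].
  have [|l1 [l1S l1l]] := IHl; first by move=> x xl; apply: lS; rewrite inE xl orbT.
  have [l2 [l2S l2a]] := ideal_finite (lS a (mem_head _ _)).
  exists (l1 ++ l2); split=> x.
    by rewrite mem_cat => /orP[/l1S|/l2S].
  rewrite inE => /orP[/eqP ->|/l1l].
    by apply: ideal_mono l2a => y yl; rewrite mem_cat yl orbT.
  by apply: ideal_mono => y yl; rewrite mem_cat yl.
by exists l'; split=> // x /Sl; apply: ideal_trans.
Qed.

(** The ascending chain condition for the ideals spanned by initial segments of a sequence: a finite
    generating list involves only bounded indices. *)
Lemma noetherian_range (u : nat -> R) : noetherian ->
  exists n, forall k, ideal (fun y => exists2 i, (i < n)%N & y = u i) (u k).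
Proof.
move=> /(_ (fun y => exists i, y = u i))[l [lu ul]].
have [n ln] : exists n, forall x, x \in l -> exists2 i, (i < n)%N & x = u i.
  elim: l lu {ul} => [|a l IHl] lu; first by exists 0%N.
  have [|n IHn] := IHl; first by move=> x xl; apply: lu; rewrite inE xl orbT.
  have [i ->] := lu a (mem_head _ _).
  exists (maxn n i.+1) => x; rewrite inE => /orP[/eqP ->|/IHn[j jn ->]].
    by exists i => //; rewrite leq_maxr.
  by exists j => //; apply: leq_trans jn (leq_maxl _ _).
exists n => k; have [] := (ul (u k)); first by exists k.
  exact: Ideal0.
by move=> a x y xl yl; apply: IdealD; [apply: ln|apply: ideal_mono yl].
Qed.

End Ideals.

(** A nonzero element of least absolute value in the ideal generates it, by Euclidean division. *)
Lemma noetherian_int : noetherian int.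
Proof.
apply: noetherian_ideal => S.
have [S0|] := pselect (forall x, S x -> x = 0).
  by exists [::]; split=> // x /S0 ->; apply: Ideal0.
move=> /existsNP[x /not_implyP[Sx /eqP x0]].
pose Q n := `[< exists d : int, [/\ ideal S d, d != 0 & absz d = n] >].
have exQ : exists n, Q n.
  by exists (absz x); apply/asboolP; exists x; split=> //; apply: ideal_gen.
have [n /asboolP[d [Sd d0 dn]] nmin] := ex_minnP exQ.
exists [:: d]; split=> [y|y Sy]; first by rewrite inE => /eqP ->.
suff /eqP r0 : (y %% d)%Z == 0.
  rewrite (divz_eq y d) r0; apply: IdealD; last exact: Ideal0.
  by rewrite inE.
apply: contraT => r0; have := nmin (absz (y %% d)%Z); rewrite leqNgt -dn.
case: ltnP => [_ /(_ _)|]; last first.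
  by have := ltz_mod y d0; have := modz_ge0 y d0; lia.
suff -> : Q `|(y %% d)%Z|%N by move/(_ isT).
apply/asboolP; exists (y %% d)%Z; split=> //.
have -> : (y %% d)%Z = y - (y %/ d)%Z * d by rewrite {2}(divz_eq y d); ring.
by apply: ideal_sub; [apply: ideal_gen | apply: ideal_mul].
Qed.

(** By contradiction: if no finite list suffices, choose successively [f n] of least size in the
    ideal of [S] but outside the ideal of the earlier choices, and compare leading coefficients. *)
Lemma hilbert_basis (R : comNzRingType) : noetherian R -> noetherian {poly R}.
Proof.
move=> HR; apply: noetherian_ideal => S; apply: contrapT => noS.
(* The condition on [l] stands inside the existential, so that [choice] yields a function defined on
   all lists. *)
have pickP (l : seq {poly R}) : exists p : {poly R},
    (forall x, x \in l -> ideal S x) ->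
    [/\ ideal S p, ~ ideal (fun y => y \in l) p &
      forall q : {poly R}, ideal S q -> (size q < size p)%N ->
        ideal (fun y => y \in l) q].
  have [lS|lS] := pselect (forall x, x \in l -> ideal S x); last by exists 0.
  pose Q n := `[< exists p : {poly R},
    [/\ ideal S p, ~ ideal (fun y => y \in l) p & size p = n] >].
  have exQ : exists n, Q n.
    apply: contrapT => noQ; apply: noS; exists l; split=> // x Sx.
    apply: contrapT => lx; apply: noQ; exists (size x); apply/asboolP.
    by exists x; split=> //; apply: ideal_gen.
  have [n /asboolP[p [Sp lp pn]] nmin] := ex_minnP exQ.
  exists p => _; split=> // q Sq qp; apply: contrapT => lq.
  have : (n <= size q)%N by apply: nmin; apply/asboolP; exists q.
  by rewrite -pn leqNgt qp.
have [pick pickE] := choice pickP.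
pose L n := iter n (fun l => pick l :: l) [::].
pose f n := pick (L n).
have LS n x : x \in L n -> ideal S x.
  elim: n x => //= n IHn x; rewrite inE => /orP[/eqP ->|]; last exact: IHn.
  by have [] := pickE (L n) (IHn).
have fP n := pickE (L n) (LS n).
have LL i n : (i <= n)%N -> {subset L i <= L n}.
  move/subnK => <-; elim: (n - i)%N => //= k IHk x /IHk xL.
  by rewrite inE xL orbT.
have fL i n : (i < n)%N -> f i \in L n.
  by move=> ltin; apply: (LL _ _ ltin); rewrite /= mem_head.
(* The leading coefficient of [f N] is a combination of those of the earlier [f i]. *)
have [N uN] := noetherian_range (fun n => lead_coef (f n)) HR.
have [SfN LfN fNmin] := fP N; rewrite -/(f N) in SfN LfN fNmin.
have size_f i : (i < N)%N -> (size (f i) <= size (f N))%N.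
  move=> ltiN; rewrite leqNgt; apply/negP => lt_size; apply: LfN.
  have [_ _ /(_ (f N) SfN lt_size)] := fP i.
  by apply: ideal_mono => y; apply: LL; apply: ltnW.
have f0 i : (0 < size (f i))%N.
  rewrite size_poly_gt0; apply/eqP => fi0; have [_ + _] := fP i.
  by rewrite -/(f i) fi0; apply; apply: Ideal0.
(* Multiplying each [f i] by the power of X that brings it to the size of [f N] lifts a combination
   of leading coefficients to a polynomial. *)
have lead a : ideal (fun y => exists2 i, (i < N)%N & y = lead_coef (f i)) a ->
    exists q : {poly R}, [/\ ideal (fun y => y \in L N) q,
      (size q <= size (f N))%N & q`_(size (f N)).-1 = a].
  elim=> [|b x y [i ltiN ->] _ [q [Lq sq qy]]].
    by exists 0; rewrite size_poly0 coef0; split=> //; apply: Ideal0.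
  have sfi := size_f i ltiN.
  exists (b%:P * 'X^(size (f N) - size (f i)) * f i + q); split.
  - by apply: ideal_add => //; apply/ideal_mul/ideal_gen/fL.
  - rewrite (leq_trans (size_polyD _ _)) // geq_max sq andbT.
    rewrite -mulrA mul_polyC (leq_trans (size_scale_leq _ _)) // mulrC.
    by rewrite size_mulXn ?subnK // -size_poly_gt0.
  - rewrite coefD qy -mulrA coefCM mulrC [_ * f i]mulrC coefMXn mulrC.
    congr (_ * _ + _); rewrite ifF; first by congr (_`_ _); lia.
    by have := f0 i; lia.
have [q [Lq sq qN]] := lead _ (uN N).
(* Subtracting [q] cancels the leading term of [f N]; by minimality of [f N], the difference lies in
   the ideal of the earlier choices, and so does [q]. *)
apply: LfN; rewrite -(subrK q (f N)); apply: ideal_add => //.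
apply: fNmin.
  by apply: ideal_sub => //; apply: ideal_trans Lq => y /LS.
have -> : size (f N) = (size (f N)).-1.+1 by rewrite prednK.
apply/leq_sizeP => j; rewrite leq_eqVlt => /orP[/eqP <-|ltj].
  by rewrite coefB qN subrr.
have sj : (size (f N) <= j)%N by have := f0 N; lia.
by rewrite coefB !nth_default ?subrr // (leq_trans sq).
Qed.

Local Close Scope ring_scope.

(** * Evaluation of polynomials *)

Local Open Scope ring_scope.

Section Evaluation.
Variables (R : comNzRingType) (g : nat -> R).

Definition natpoly_val (p : natpoly) : R := \sum_(m <- p) \prod_(v <- m) g v.

Lemma natpoly_val_cat p q : natpoly_val (p ++ q) = natpoly_val p + natpoly_val q.
Proof. exact: big_cat. Qed.

Lemma natpoly_val_cons m p : natpoly_val (m :: p) = \prod_(v <- m) g v + natpoly_val p.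
Proof. exact: big_cons. Qed.

Lemma natpoly_val_nseq k : natpoly_val (nseq k [::]) = k%:R.
Proof.
elim: k => [|k IHk]; first exact: big_nil.
by rewrite natpoly_val_cons big_nil IHk -natr1 addrC.
Qed.

Lemma natpoly_val_mulm m p :
  natpoly_val (map (cat m) p) = \prod_(v <- m) g v * natpoly_val p.
Proof.
rewrite /natpoly_val big_map mulr_sumr.
by apply: eq_bigr => m' _; rewrite big_cat.
Qed.

Lemma natpoly_val_scale v p : natpoly_val (natpoly_scale v p) = g v * natpoly_val p.
Proof. by have := natpoly_val_mulm [:: v] p; rewrite big_seq1. Qed.

Definition letter_mx (b : letter) : 'M[R]_2 :=
  \matrix_(i, j) g (var b (2 * i + j)).

Lemma natpoly_val_word w :
  natpoly_val (word_poly w) = (\prod_(b <- w) letter_mx b) 1 0.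
Proof.
suff [_ ->] : natpoly_val (foldr letter_act ([:: [::]], [::]) w).1 =
    (\prod_(b <- w) letter_mx b) 0 0 /\
  natpoly_val (foldr letter_act ([:: [::]], [::]) w).2 =
    (\prod_(b <- w) letter_mx b) 1 0 by [].
elim: w => [|b w [IH0 IH1]] /=.
  by rewrite /natpoly_val !big_seq1 !big_nil !mxE.
rewrite !natpoly_val_cat !natpoly_val_scale big_cons IH0 IH1 -mulmxE !mxE.
rewrite !big_ord_recl !big_ord0 !mxE !addr0.
by have -> : lift ord0 ord0 = 1 :> 'I_2 by apply/val_inj.
Qed.

Lemma natpoly_val_combination W C : natpoly_val (combination W C) =
  \sum_(t <- C) (\prod_(v <- behead t) g v *
                 natpoly_val (word_poly (nth [::] W (head 0%N t)))).
Proof.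
elim: C => [|t C IH]; first by rewrite /natpoly_val !big_nil.
rewrite /combination /= natpoly_val_cat -/(combination W C) IH big_cons.
by rewrite natpoly_val_mulm.
Qed.

Lemma natpoly_eq_val p q : natpoly_eq p q -> natpoly_val p = natpoly_val q.
Proof.
move=> pq; have val_sort r : natpoly_val (map (sort leq) r) = natpoly_val r.
  rewrite /natpoly_val big_map; apply: eq_bigr => m _.
  by apply/perm_big; rewrite perm_sort.
have count_sort m r : count_mem (sort leq m) (map (sort leq) r) = count (perm_eq m) r.
  rewrite count_map; apply: eq_count => m' /=; rewrite eq_sym.
  exact/eqP/(perm_sortP leq_total leq_trans anti_leq).
rewrite -val_sort -[RHS]val_sort; apply/perm_big/allP => m'.
rewrite -map_cat => /mapP[m mpq ->]; rewrite /= !count_sort.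
exact: (allP pq).
Qed.

End Evaluation.

Lemma natpoly_val_morph (R S : comNzRingType) (h : {rmorphism R -> S}) g p :
  h (natpoly_val g p) = natpoly_val (h \o g) p.
Proof.
by rewrite rmorph_sum; apply: eq_bigr => m _; rewrite rmorph_prod.
Qed.

Lemma eq_natpoly_val (R : comNzRingType) (g g' : nat -> R) (p : natpoly) :
  (forall m v, m \in p -> v \in m -> g v = g' v) ->
  natpoly_val g p = natpoly_val g' p.
Proof.
move=> gg'; apply: eq_big_seq => m mp; apply: eq_big_seq => v.
exact: gg'.
Qed.

(** * Integer polynomials in finitely many variables *)

Fixpoint ipoly (n : nat) : comNzRingType :=
  if n is n'.+1 then {poly ipoly n'} : comNzRingType else int.

(** The variable of index n - 1 is the outermost one; indices from n on are sent to 0. *)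
Fixpoint ivar (n v : nat) : ipoly n :=
  match n with
  | 0 => 0
  | n'.+1 => if v == n' then 'X else (ivar n' v)%:P
  end.

Lemma noetherian_ipoly n : noetherian (ipoly n).
Proof.
by elim: n => [|n IHn]; [apply: noetherian_int | apply: hilbert_basis].
Qed.

Definition vars_lt (n : nat) (p : natpoly) : bool := all (all (ltn^~ n)) p.

(** The coefficient of the d-th power of variable [n], as a polynomial in the other variables. *)
Definition slice (n d : nat) (p : natpoly) : natpoly :=
  [seq filter (predC1 n) m | m <- p & count_mem n m == d].

Lemma ipoly_coef n d p :
  (natpoly_val (ivar n.+1) p)`_d = natpoly_val (ivar n) (slice n d p).
Proof.
have mono m : \prod_(v <- m) ivar n.+1 v =
    (\prod_(v <- filter (predC1 n) m) ivar n v)%:P * 'X^(count_mem n m).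
  elim: m => [|v m IHm]; first by rewrite !big_nil mulr1.
  rewrite big_cons IHm /=; case: eqVneq => [->|vn] /=.
    by rewrite add1n exprS; ring.
  by rewrite big_cons polyCM add0n mulrA.
elim: p => [|m p IHp]; first by rewrite /natpoly_val !big_nil coef0.
rewrite natpoly_val_cons coefD IHp mono coefCM coefXn /slice /=.
rewrite eq_sym; case: eqVneq => _ /=; first by rewrite natpoly_val_cons mulr1.
by rewrite mulr0 add0r.
Qed.

Lemma perm_eq_slice (n : nat) (m m' : seq nat) :
  perm_eq m m' = (count_mem n m' == count_mem n m) &&
    perm_eq (filter (predC1 n) m) (filter (predC1 n) m').
Proof.
apply/idP/andP => [mm'|[/eqP cn mm']].
  by rewrite perm_filter // (permP mm').
rewrite -(perm_filterC (pred1 n) m).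
apply: perm_trans (permEl (perm_filterC (pred1 n) m')).
apply: perm_cat => //.
have E s : filter (pred1 n) s = nseq (count_mem n s) n.
  by rewrite -size_filter; apply/all_pred1P/filter_all.
by rewrite !E cn.
Qed.

Lemma count_slice n (m : seq nat) p :
  count (perm_eq m) p =
  count (perm_eq (filter (predC1 n) m)) (slice n (count_mem n m) p).
Proof.
rewrite /slice count_map count_filter; apply: eq_count => m' /=.
by rewrite (perm_eq_slice n) andbC.
Qed.

Lemma vars_lt_slice n d p : vars_lt n.+1 p -> vars_lt n (slice n d p).
Proof.
move=> /allP pn; apply/allP => m' /mapP[m]; rewrite mem_filter => /andP[_ mp] ->.
apply/allP => v; rewrite mem_filter => /andP[vn vm].
by have := allP (pn m mp) v vm; rewrite /= ltnS leq_eqVlt (negPf vn).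
Qed.

(** This turns identities in the polynomial ring into the syntactic test of the algorithm. Induct on
    the number of variables, comparing coefficients in the last one; without variables, only the
    multiplicity of the empty monomial remains, and it is determined by its value in the
    integers. *)
Lemma ivar_independent n p q :
  vars_lt n p -> vars_lt n q ->
  natpoly_val (ivar n) p = natpoly_val (ivar n) q -> natpoly_eq p q.
Proof.
move=> pn qn pq; suff E m : count (perm_eq m) p = count (perm_eq m) q.
  by apply/allP => m _; rewrite /= E.
elim: n p q m pn qn pq => [|n IHn] p q m pn qn pq.
  have nilE r : vars_lt 0 r -> r = nseq (size r) [::].
    by move=> r0; apply/all_pred1P; apply: sub_all r0 => -[|v s].
  move: pq; rewrite (nilE p) // (nilE q) // !natpoly_val_nseq => /eqP.
  by rewrite eqr_nat => /eqP ->.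
rewrite (count_slice n) [RHS](count_slice n).
apply: IHn; rewrite ?vars_lt_slice //.
by rewrite -!ipoly_coef pq.
Qed.

Lemma natpoly_val_ivarS n p : vars_lt n p ->
  natpoly_val (ivar n.+1) p = (natpoly_val (ivar n) p)%:P.
Proof.
move=> /allP pn; rewrite (natpoly_val_morph polyC) /=.
apply: eq_natpoly_val => m v mp vm /=.
by have := allP (pn m mp) v vm; case: eqVneq => // -> /=; rewrite ltnn.
Qed.

(** The two parts of a multiplier feed the two sides of a certificate. *)
Lemma ipoly_natpoly n (x : ipoly n) : exists a b,
  [/\ vars_lt n a, vars_lt n b &
    x = natpoly_val (ivar n) a - natpoly_val (ivar n) b].
Proof.
elim: n x => [|n IHn] x.
  have v0 k : vars_lt 0 (nseq k [::]) by rewrite /vars_lt all_nseq orbT.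
  have nil0 : natpoly_val (ivar 0) [::] = 0 by apply: big_nil.
  case: x => k.
    exists (nseq k [::]), [::]; split=> //.
    by rewrite natpoly_val_nseq nil0 subr0; apply/esym/natz.
  exists [::], (nseq k.+1 [::]); split=> //.
  by rewrite natpoly_val_nseq nil0 sub0r NegzE; congr (- _); apply/esym/natz.
have vS p : vars_lt n p -> vars_lt n.+1 p.
  by apply: sub_all => m; apply: sub_all => v; apply: ltnW.
(* The element is given the type [{poly ipoly n}], for which [poly_ind] applies. *)
have [q qx] : exists q : {poly ipoly n}, q = x by exists x.
rewrite -{}qx {x}; elim/poly_ind: q => [|q c [a [b [an bn ->]]]].
  by exists [::], [::]; split=> //; rewrite subrr.
have [a' [b' [a'n b'n ->]]] := IHn c.
have scn p : vars_lt n.+1 p -> vars_lt n.+1 (natpoly_scale n p).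
  by rewrite /vars_lt all_map; apply: sub_all => m /= ->; rewrite ltnSn.
exists (natpoly_scale n a ++ a'), (natpoly_scale n b ++ b').
split; try by rewrite /vars_lt all_cat; apply/andP; split;
  [apply: scn | apply: vS].
rewrite !natpoly_val_cat !natpoly_val_scale (natpoly_val_ivarS a'n).
rewrite (natpoly_val_ivarS b'n) /= eqxx polyCB.
by ring.
Qed.

Lemma vars_lt_word n (w : seq letter) :
  all (fun b => enc b < n)%N w -> vars_lt (n * 4) (word_poly w).
Proof.
move=> wn; have scale_lt b k p : (enc b < n)%N -> (k < 4)%N ->
    vars_lt (n * 4) p -> vars_lt (n * 4) (natpoly_scale (var b k) p).
  move=> bn k4; rewrite /vars_lt all_map; apply: sub_all => m /= ->.
  by rewrite andbT /var; lia.
suff [] : vars_lt (n * 4) (foldr letter_act ([:: [::]], [::]) w).1 /\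
    vars_lt (n * 4) (foldr letter_act ([:: [::]], [::]) w).2 by [].
elim: w wn => //= b w IHw /andP[bn /IHw[w0 w1]].
by rewrite /vars_lt !all_cat -!/(vars_lt _ _) !scale_lt.
Qed.

Lemma vars_lt_combination n W C :
  (forall w, w \in W -> all (fun b => enc b < n)%N w) ->
  vars_lt (n * 4) (map behead C) -> vars_lt (n * 4) (combination W C).
Proof.
move=> Wn; elim: C => //= t C IHC /andP[tn /IHC Cn].
rewrite /combination /= /vars_lt all_cat -!/(vars_lt _ _) Cn andbT.
have : vars_lt (n * 4) (word_poly (nth [::] W (head 0%N t))).
  have [ltt|get] := ltnP (head 0%N t) (size W); last by rewrite nth_default.
  exact/vars_lt_word/Wn/mem_nth.
by rewrite /vars_lt all_map; apply: sub_all => m mn; rewrite /= all_cat tn.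
Qed.

(** The letters have codes below [n], so 4n variables suffice. Among the polynomials of the words of
    all levels, finitely many generate the others, and as the levels increase these all come from a
    single level [k]. *)
Lemma certificates_exist n (W : nat -> seq (seq letter)) :
  (forall k, {subset W k <= W k.+1}) ->
  (forall k w, w \in W k -> all (fun b => enc b < n)%N w) ->
  exists k, forall j t, t \in W j -> exists N C,
    natpoly_eq (word_poly t ++ combination (W k) N) (combination (W k) C).
Proof.
move=> Winc Wn; set g := ivar (n * 4).
have Wle i j : (i <= j)%N -> {subset W i <= W j}.
  by move/subnK => <-; elim: (j - i)%N => //= d IHd x /IHd; apply: Winc.
have [l [lS Sl]] := @noetherian_ipoly (n * 4)
  (fun x => exists j, exists2 t, t \in W j & x = natpoly_val g (word_poly t)).
have [k lk] : exists k, forall x, x \in l ->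
    exists2 w, w \in W k & x = natpoly_val g (word_poly w).
  elim: l lS {Sl} => [|a l IHl] lS; first by exists 0%N.
  have [|k IHk] := IHl; first by move=> x xl; apply: lS; rewrite inE xl orbT.
  have [j [w wj ->]] := lS a (mem_head _ _).
  exists (maxn k j) => x; rewrite inE => /orP[/eqP ->|/IHk[v vk ->]].
    by exists w => //; apply: Wle wj; apply: leq_maxr.
  by exists v => //; apply: Wle vk; apply: leq_maxl.
exists k => j t tj.
have cert x : ideal (fun y => y \in l) x -> exists N C,
    [/\ vars_lt (n * 4) (map behead N), vars_lt (n * 4) (map behead C) &
      x + natpoly_val g (combination (W k) N) =
      natpoly_val g (combination (W k) C)].
  elim=> [|a y z /lk[w wk ->] _ [N [C [Nn Cn NC]]]].
    by exists [::], [::]; split=> //; rewrite add0r.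
  have [p [q [pn qn ->]]] := ipoly_natpoly a.
  pose i := index w (W k).
  (* The multiplier is p - q: the terms of [q] join the negative part [N], those of [p] the positive
     part [C]. *)
  exists (map (cons i) q ++ N), (map (cons i) p ++ C).
  have beheadK r : map behead (map (cons i) r) = r.
    by rewrite -map_comp map_id.
  have valE r D : natpoly_val g (combination (W k) (map (cons i) r ++ D)) =
      natpoly_val g r * natpoly_val g (word_poly w) +
      natpoly_val g (combination (W k) D).
    rewrite !natpoly_val_combination big_cat big_map /= nth_index //.
    by rewrite -mulr_suml.
  split; try by rewrite map_cat beheadK /vars_lt all_cat; apply/andP.
  by rewrite !valE -NC; ring.
have [|N [C [Nn Cn NC]]] := cert (natpoly_val g (word_poly t)).
  by apply: Sl; exists j, t.
exists N, C; apply: ivar_independent; last by rewrite natpoly_val_cat; exact: NC.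
  rewrite /vars_lt all_cat -!/(vars_lt _ _).
  by rewrite vars_lt_word ?(Wn j) // vars_lt_combination // => w; apply: Wn.
by apply: vars_lt_combination => // w; apply: Wn.
Qed.

Local Close Scope ring_scope.

(** * Free groups of integer matrices *)

Local Open Scope ring_scope.

Lemma ord2P (i : 'I_2) : i = 0 \/ i = 1.
Proof. by case: i => [[|[|i]] ?] //; [left|right]; apply: val_inj. Qed.

Lemma mxE2 (R : pzSemiRingType) (A B : 'M[R]_2) i j :
  (A *m B) i j = A i 0 * B 0 j + A i 1 * B 1 j.
Proof.
rewrite !mxE !big_ord_recl big_ord0 addr0.
by have -> : lift ord0 ord0 = 1 :> 'I_2 by apply/val_inj.
Qed.

Section PingPong.
Variables (X : choiceType) (p : X -> int).

Definition exponent (a : signed X) : int := if a.2 then -5 else 5.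

(* 1 + c v v', where v is the column (p, 1), v' is the row (1, -p), and c is 5
   or -5: a parabolic element fixing v, whose inverse is obtained by changing
   the sign of c as v' v = 0. *)
Definition parabolic (a : signed X) : 'M[int]_2 :=
  let c := exponent a in let q := p a.1 in
  \matrix_(i, j) if i == 0 then if j == 0 then 1 + c * q else - (c * q * q)
                 else if j == 0 then c else 1 - c * q.

Definition word_mx (w : seq (signed X)) : 'M[int]_2 :=
  \prod_(a <- w) parabolic a.

Lemma exponent_inv a : exponent (letter_inv a) = - exponent a.
Proof. by rewrite /exponent /=; case: a.2. Qed.

Lemma parabolic_inv a : parabolic a * parabolic (letter_inv a) = 1.
Proof.
apply/matrixP => i j; rewrite -mulmxE mxE2 !mxE exponent_inv /=.
by case: (ord2P i) => ->; case: (ord2P j) => -> /=; ring.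
Qed.

Lemma word_mx_push a w : word_mx (push a w) = parabolic a * word_mx w.
Proof.
rewrite /word_mx; case: w => [|b w] /=; first by rewrite big_seq1 big_nil mulr1.
case: eqP => [->|_]; last by rewrite big_cons.
by rewrite big_cons mulrA parabolic_inv mul1r.
Qed.

Lemma word_mxM (x y : Defs.free X) :
  word_mx (free_word (x * y)%g) = word_mx (free_word x) * word_mx (free_word y).
Proof.
rewrite /=; elim: (free_word x) => [|a w IHw] /=.
  by rewrite /word_mx big_nil mul1r.
by rewrite word_mx_push IHw mulrA /word_mx big_cons.
Qed.

(* The image of (1, 0) under a reduced word starting with a lies in the domain
   D_a = {2 q^2 < +- y q}, q = x - p y; these domains are pairwise disjoint. *)
Lemma ping_pong a w :
  {in map fst (a :: w) &, injective p} -> reduced (a :: w) ->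
  let x := word_mx (a :: w) 0 0 in let y := word_mx (a :: w) 1 0 in
  let q := x - p a.1 * y in 10 * q * q < exponent a * y * q.
Proof.
(* In the coordinates q and y, [parabolic b] fixes q and adds [exponent b * q] to y. *)
have step b (A : 'M[int]_2) : let x := A 0 0 in let y := A 1 0 in
    let q := x - p b.1 * y in
    (parabolic b * A) 0 0 - p b.1 * (parabolic b * A) 1 0 = q /\
    (parabolic b * A) 1 0 = y + exponent b * q.
  by rewrite -mulmxE !mxE2 !mxE /=; split; ring.
have exp2 b : exponent b * exponent b = 25 by rewrite /exponent; case: b.2.
have expand b y q :
    exponent b * (y + exponent b * q) * q = exponent b * y * q + 25 * q * q.
  by rewrite -(exp2 b); ring.
elim: w a => [|b w IHw] a pinj red_w; cbv zeta.
  rewrite /word_mx big_seq1 -[parabolic a]mulr1.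
  have [-> ->] := step a 1.
  by rewrite !mxE /= !(mulr0, subr0, add0r, mulr1) exp2.
have -> : word_mx [:: a, b & w] = parabolic a * word_mx (b :: w).
  by rewrite /word_mx big_cons.
have [-> ->] := step a (word_mx (b :: w)).
have /andP[ba red_w'] : (b != letter_inv a) && reduced (b :: w) by [].
have pinj' : {in map fst (b :: w) &, injective p}.
  by move=> u v uw vw; apply: pinj; rewrite inE ?uw ?vw orbT.
have := IHw b pinj' red_w'; move: (word_mx _ 0 0) (word_mx _ 1 0) => x y /=.
(* With equal generators, reducedness forces a = b: then q is kept and 25 q^2 is added to the
   right-hand side. *)
have [eab|nab] := eqVneq a.1 b.1.
  have -> : exponent b = exponent a.
    move: ba; rewrite -[b != _]/(~~ ((b.1 == a.1) && (b.2 == ~~ a.2))).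
    by rewrite -eab eqxx /exponent; case: (a.2); case: (b.2).
  rewrite eab expand; move: (x - p b.1 * y) => q H.
  by have := sqr_ge0 q; rewrite expr2; lia.
have pab : p a.1 != p b.1.
  apply: contra nab => /eqP /pinj; rewrite !inE !eqxx orbT => -> //.
move: (p a.1) (p b.1) pab => r s rs H.
have exp_norm c : `|exponent c| = 5 by rewrite /exponent; case: c.2.
(* The induction hypothesis gives |q'| < |y| / 2. As r and s are distinct integers, |y| is at most
   |q| + |q'|, whence |q| > |y| / 2. *)
set q := x - r * y; set q' := x - s * y in H.
have q'_norm : 2 * `|q'| < `|y|.
  have q'0 : 0 < `|q'|.
    by rewrite normr_gt0; apply: contraTneq H => ->; rewrite !mulr0.
  have := lt_le_trans H (ler_norm _); rewrite !normrM exp_norm -mulrA -expr2.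
  by rewrite -real_normK ?num_real //; nia.
have q_norm : `|y| < 2 * `|q|.
  have : `|(s - r) * y| <= `|q| + `|q'|.
    by rewrite (_ : (s - r) * y = q - q') ?ler_normB // /q /q'; ring.
  have : 1 <= `|s - r| by rewrite -gtz0_ge1 normr_gt0 subr_eq0 eq_sym.
  by rewrite normrM; nia.
(* As |y| < 2 |q|, this term is at least -10 q^2, which is more than compensated by 25 q^2: the
   rest, 15 q^2, exceeds 10 q^2. *)
have : - (5 * `|y| * `|q|) <= exponent a * y * q.
  by rewrite -(exp_norm a) -!normrM lerNl -normrN ler_norm.
have : q * q = `|q| * `|q| by rewrite -normrM ger0_norm // -expr2 sqr_ge0.
rewrite expand; nia.
Qed.

End PingPong.

(** Injectivity of [p] is needed only on the generators occurring in [u], so their positions in the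
    word serve as values. If the entry y vanished, ping-pong would give 10 q^2 < 0. *)
Lemma word_mx_separates (X : choiceType) (u : Defs.free X) :
  u <> 1%g -> exists p, word_mx p (free_word u) 1 0 != 0.
Proof.
move=> u1; pose s := map fst (free_word u).
pose p x : int := index x s; exists p.
have : {in s &, injective p}.
  by move=> x y xs ys [] /index_inj; apply.
move: p u1 (free_wordP u); rewrite {}/s => p u1.
have : free_word u != [::].
  by apply: contra_notN u1 => /eqP u1; apply: val_inj.
case: (free_word u) => // a w _ red_w pinj.
have := ping_pong pinj red_w; cbv zeta; apply: contraTneq => ->.
rewrite !mulr0 mul0r subr0 -leNgt.
by rewrite -mulrA -expr2 mulr_ge0 ?sqr_ge0.
Qed.

Local Close Scope ring_scope.

(** * Residually free images *)

Local Open Scope group_scope.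

Section Morphisms.
Variables (G H : groupType).

Lemma morph_one (f : G -> H) : {morph f : x y / x * y} -> f 1 = 1.
Proof. by move=> fM; apply: (mulgI (f 1)); rewrite -fM !mulg1. Qed.

Definition morphism_of (f : G -> H) (fM : {morph f : x y / x * y}) :
    UMagmaMorphism.type G H :=
  HB.pack f (isUMagmaMorphism.Build G H f (morph_one fM, fM)).

Lemma morph_eq (f : UMagmaMorphism.type G H) x y :
  f x = f y <-> f (x^-1 * y) = 1.
Proof.
rewrite gmulfM gmulfV; split=> [->|/eqP]; first exact: mulVg.
by rewrite mulg_eq1 => /eqP/invg_inj.
Qed.

Definition morph_kernel (f : UMagmaMorphism.type G H) : normal_subgroup G.
Proof.
exists [set x | f x = 1]%classic => [|x y /= fx].
  split=> /= [|x y fx fy|x fx]; first exact: gmulf1.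
    by rewrite gmulfM fx fy mulg1.
  by rewrite gmulfV fx invg1.
by rewrite /conjg !gmulfM gmulfV fx mul1g mulVg.
Defined.

End Morphisms.

Section Quotients.
Variable G : groupType.

Lemma quot_lift (N : normal_subgroup G) (H : groupType)
    (f : UMagmaMorphism.type G H) : (forall x, N x -> f x = 1) ->
  exists f' : UMagmaMorphism.type (quotient N) H,
    forall x, f' (quot_proj N x) = f x.
Proof.
move=> fN; pose f' (a : quotient N) := f (quot_repr a).
have f'E x : f' (quot_proj N x) = f x.
  by apply/morph_eq/fN/quot_projP; rewrite quot_reprK.
have f'M : {morph f' : a b / a * b}.
  move=> a b; rewrite -(quot_reprK a) -(quot_reprK b) -quot_projM !f'E.
  exact: gmulfM.
by exists (morphism_of f'M).
Qed.

(** Morphisms from the quotient to free groups correspond to the morphisms from [G] that kill [R]: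
    one lifts them in one direction and composes with the projection in the other. *)
Lemma residually_free_projP (R : set G) x y :
  quot_proj (kappa (quotient (nclosure R))) (quot_proj (nclosure R) x) =
  quot_proj (kappa (quotient (nclosure R))) (quot_proj (nclosure R) y) <->
  forall (X : choiceType) (f : UMagmaMorphism.type G (Defs.free X)),
    (forall r, R r -> f r = 1) -> f x = f y.
Proof.
rewrite quot_projP -quot_projV -quot_projM; split=> [kxy X f fR|xy X f].
  have [|f' f'E] := @quot_lift (nclosure R) _ f.
    by move=> z /(_ (morph_kernel f)); apply.
  by apply/morph_eq; rewrite -f'E; apply: kxy.
pose p := morphism_of (@quot_projM G (nclosure R)).
apply: (proj1 (morph_eq (f \o p) x y)); apply: xy => r Rr.
rewrite -[LHS]/(f (quot_proj _ r)) (_ : quot_proj _ r = 1) ?gmulf1 //.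
by apply/esym/quot_projP; rewrite invg1 mul1g => N; apply.
Qed.

End Quotients.

(** Two elements have the same image exactly when the morphisms killing the relators do not separate
    them, and both presentations have the same such morphisms. Hence going through representatives
    gives well-defined inverse maps. *)
Lemma marked_eq_residually_free n (V W : set (seq (signed 'I_n))) :
  (forall (X : choiceType)
      (f : UMagmaMorphism.type (Defs.free 'I_n) (Defs.free X)),
    (forall w, V w -> f (word_val (@free_gen _) w) = 1) <->
    (forall w, W w -> f (word_val (@free_gen _) w) = 1)) ->
  marked_eq (residually_free_image (presented V))
            (residually_free_image (presented W)).
Proof.
move=> VW; pose rels U := [set word_val (@free_gen 'I_n) w | w in U]%classic.
pose proj U x := quot_proj (kappa (quotient (nclosure (rels U))))
  (quot_proj (nclosure (rels U)) x).
pose sect U a := quot_repr (quot_repr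
  (a : quotient (kappa (quotient (nclosure (rels U)))))).
have sectK U a : proj U (sect U a) = a by rewrite /proj !quot_reprK.
have projE x y : proj V x = proj V y <-> proj W x = proj W y.
  split=> /residually_free_projP xy; apply/residually_free_projP => X f fU;
    apply: xy => _ [w Uw <-].
    by apply: (proj2 (VW X f)) => // v Wv; apply: fU; exists v.
  by apply: (proj1 (VW X f)) => // v Wv; apply: fU; exists v.
have projM U x y : proj U (x * y) = proj U x * proj U y.
  by rewrite /proj !quot_projM.
pose h a := proj W (sect V a).
have hE x : h (proj V x) = proj W x by apply/projE; rewrite sectK.
have hM : {morph h : a b / a * b}.
  by move=> a b; rewrite -(sectK V a) -(sectK V b) -projM !hE projM.
exists (morphism_of hM); split; last by move=> i; apply: hE.
exists (fun b => proj V (sect W b)) => [a|b] /=.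
  by rewrite -(sectK V a) hE; apply/projE; rewrite sectK.
by rewrite hE sectK.
Qed.

Local Close Scope group_scope.

(** * The algorithm and its correctness *)

#[export] Instance presentation_encodable : encodable edt0l_presentation :=
  Encodable enc_presentation
    (@EDT0LPresentation 0 0 (@EDT0L (signed 'I_0) 'I_0 [::] [::])).

Lemma codeI : injective CodeSeq.code.
Proof. exact: can_inj CodeSeq.codeK. Qed.

Lemma enc_signed_inj n : injective (@enc_signed n).
Proof.
move=> [i e] [j e'] /codeI[/ord_inj -> ee']; congr (_, _).
by case: e e' ee' => [] [].
Qed.

Lemma enc_map A T {eT : encodable T} (f : A -> T) (e : A -> nat) s :
  (forall a, enc (f a) = e a) -> enc (map f s) = enc_seq e s.
Proof.
by move=> fe; rewrite -[LHS]/(enc_seq enc _) /enc_seq -map_comp (eq_map fe).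
Qed.

Section Raw.
Variable P : edt0l_presentation.
Local Notation n := (pres_rank P).
Local Notation m := (pres_extra P).
Local Notation B := (signed 'I_n + 'I_m)%type.
Local Notation D := (pres_system P).
Implicit Types (b : B) (w u : seq B).

(** The data of [P] are copied into types that do not depend on [P], where the computability lemmas
    apply; the codes stay the same. *)
Definition raw_letter b : letter :=
  match b with inl a => (0, enc_signed a) | inr j => (1, val j) end.

Definition raw_word w : seq letter := map raw_letter w.

Definition raw_endo (phi : word_endo B) : seq (letter * seq letter) :=
  [seq (raw_letter b, raw_word (phi b)) | b <- enum {: B}].

Definition raw_axiom : seq letter := raw_word (edt0l_axiom D).
Definition raw_endos := map raw_endo (edt0l_endos D).
Definition raw_levels k := levels raw_endos raw_axiom k.

Lemma enc_raw_letter b : enc (raw_letter b) = enc_letter b.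
Proof. by case: b. Qed.

Lemma enc_raw_word w : enc (raw_word w) = enc_seq (@enc_letter n m) w.
Proof. exact: enc_map enc_raw_letter. Qed.

Lemma enc_raw_endos : enc raw_endos = enc_seq (@enc_endo n m) (edt0l_endos D).
Proof.
apply: enc_map => phi; apply: enc_map => b.
rewrite -[LHS]/(CodeSeq.code [:: enc (raw_letter b); enc (raw_word (phi b))]).
by rewrite enc_raw_letter enc_raw_word.
Qed.

Lemma enc_raw_letter_inj : injective (fun b => enc (raw_letter b)).
Proof.
move=> b b'; rewrite !enc_raw_letter; case: b => [a|j]; case: b' => [a'|j'] //.
- by move=> /codeI[/enc_signed_inj ->].
- by move=> /codeI.
- by move=> /codeI.
- by move=> /codeI[/ord_inj ->].
Qed.

Lemma raw_word_inj : injective raw_word.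
Proof. by apply: inj_map => b b' bb'; apply: enc_raw_letter_inj; rewrite bb'. Qed.

Lemma lookup_raw phi b : lookup (raw_endo phi) (raw_letter b) = raw_word (phi b).
Proof.
rewrite /raw_endo; have : b \in enum {: B} by rewrite mem_enum.
elim: (enum _) => //= c s IHs; rewrite inE (inj_eq enc_raw_letter_inj).
by case: eqVneq => [->|_ /IHs].
Qed.

Lemma subst_raw phi w : subst (raw_endo phi) (raw_word w) = raw_word (endo_app phi w).
Proof.
rewrite /subst /endo_app /raw_word map_flatten -!map_comp; congr flatten.
by apply: eq_map => b; apply: lookup_raw.
Qed.

Lemma next_levelP (W : seq (seq letter)) v :
  reflect (exists phi t, [/\ phi \in edt0l_endos D, t \in W &
             v = subst (raw_endo phi) t])
          (v \in next_level raw_endos W).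
Proof.
apply: (iffP flattenP) => [[s] /mapP[_ /mapP[phi phiD ->] ->] /mapP[u uW ->]|].
  by exists phi, u.
move=> [phi [t [phiD tW ->]]]; exists (map (subst (raw_endo phi)) W).
  exact/map_f/map_f.
exact: map_f.
Qed.

Lemma raw_levelsS k :
  raw_levels k.+1 = raw_levels k ++ next_level raw_endos (raw_levels k).
Proof. by []. Qed.

Lemma raw_levels_sound k v : v \in raw_levels k ->
  exists j w, edt0l_iter D j w /\ v = raw_word w.
Proof.
elim: k v => [|k IHk] v.
  by rewrite inE => /eqP ->; exists 0, (edt0l_axiom D); split=> //; exists [::].
rewrite raw_levelsS mem_cat => /orP[/IHk //|/next_levelP[phi [u [phiD + ->]]]].
move=> /IHk[j [w [[phis [_ phisD ->]] ->]]].
exists (size phis).+1, (endo_app phi (foldr (@endo_app _) (edt0l_axiom D) phis)).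
rewrite subst_raw; split=> //; exists (phi :: phis); split=> // psi.
by rewrite inE => /orP[/eqP ->|/phisD].
Qed.

Lemma certifiesP (W T : seq (seq letter)) certs :
  reflect (forall t, t \in T -> exists N C, [/\ N \in certs, C \in certs &
      natpoly_eq (word_poly t ++ combination W N) (combination W C)])
    (certifies W T certs).
Proof.
apply: (iffP allP) => H t /H => [/hasP[N Nc /hasP[C Cc NC]]|[N [C [Nc Cc NC]]]].
  by exists N, C.
by apply/hasP; exists N => //; apply/hasP; exists C.
Qed.

(* The number of levels is read off the size of the first certificate. *)
Definition accepts (c : nat) : bool :=
  let certs := decode_certs c in
  let W := raw_levels (size (head [::] certs)) in
  certifies W (next_level raw_endos W) certs.

(** Termination of the search: all derived words use the finitely many letters of the system, so
    [certificates_exist] applies, and the certificates for the next level form a finite list. *)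
Lemma accepts_exists : exists c, accepts c.
Proof.
pose N := \max_(b : B) (enc_letter b).+1.
have inc k : {subset raw_levels k <= raw_levels k.+1}.
  by move=> v vk; rewrite raw_levelsS mem_cat vk.
have bound k v : v \in raw_levels k -> all (fun c : letter => enc c < N) v.
  move=> /raw_levels_sound[_ [w [_ ->]]]; rewrite all_map; apply/allP => b _.
  rewrite -[preim _ _ _]/(enc (raw_letter b) < N) enc_raw_letter.
  exact: (bigop.leq_bigmax (F := fun b : B => (enc_letter b).+1) b).
have [k kP] := certificates_exist inc bound.
have nextP t : t \in next_level raw_endos (raw_levels k) ->
    exists N C, natpoly_eq (word_poly t ++ combination (raw_levels k) N)
                           (combination (raw_levels k) C).
  by move=> tk; apply: (kP k.+1); rewrite raw_levelsS mem_cat tk orbT.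
have [certs certsP] : exists certs : seq natpoly, forall t,
    t \in next_level raw_endos (raw_levels k) ->
    exists N C, [/\ N \in certs, C \in certs &
      natpoly_eq (word_poly t ++ combination (raw_levels k) N)
                 (combination (raw_levels k) C)].
  elim: (next_level _ _) nextP => [|t T IHT] nextP; first by exists [::].
  have [|certs IH] := IHT; first by move=> s sT; apply: nextP; rewrite inE sT orbT.
  have [N1 [C1 NC]] := nextP t (mem_head _ _).
  exists [:: N1, C1 & certs] => s; rewrite inE.
  case/orP => [/eqP ->|/IH[N2 [C2 [Ns Cs NC2]]]].
    by exists N1, C1; rewrite !inE !eqxx orbT.
  by exists N2, C2; rewrite !inE Ns Cs !orbT.
(* The first entry has length [k] in order to announce the level. *)
exists (enc (nseq k [::] :: certs)); rewrite /accepts decode_certsK /= size_nseq.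
apply/certifiesP => t /certsP[N1 [C1 [Nc Cc NC]]].
by exists N1, C1; rewrite !inE Nc Cc !orbT.
Qed.

Definition stable_level : nat :=
  size (head [::] (decode_certs (ex_minn accepts_exists))).

Lemma stable_levelP : exists certs, certifies (raw_levels stable_level)
  (next_level raw_endos (raw_levels stable_level)) certs.
Proof.
by rewrite /stable_level; case: ex_minnP => c; exists (decode_certs c).
Qed.

Definition raw_relators : seq (seq nat) :=
  terminal_words (raw_levels stable_level).

Lemma terminal_raw w : all (fun c : letter => c.1 == 0) (raw_word w) ->
  exists w' : seq (signed 'I_n), w = map inl w'.
Proof.
elim: w => [|[a|j] w IHw] //=; first by exists [::].
by move=> /IHw[w' ->]; exists (a :: w').
Qed.

Lemma raw_relatorsP (w : seq (signed 'I_n)) :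
  (map (@enc_signed n) w \in raw_relators) =
  (raw_word (map inl w) \in raw_levels stable_level).
Proof.
have sndE (u : seq (signed 'I_n)) : map snd (raw_word (map inl u)) = map (@enc_signed n) u.
  by rewrite /raw_word -!map_comp.
apply/mapP/idP => [[v]|wl].
  rewrite mem_filter => /andP[v0 vl] /esym vw.
  have [_ [u [_ vu]]] := raw_levels_sound vl; subst v.
  have [u' uu'] := terminal_raw v0; subst u.
  by move: vw; rewrite sndE => /(inj_map (@enc_signed_inj n)) <-.
exists (raw_word (map inl w)); last by rewrite sndE.
by rewrite mem_filter wl andbT; apply/allP => b /mapP[_ /mapP[a _ ->] ->].
Qed.

(** The words computed as lists of numbers are retyped as words over the signed generators, with
    unchanged codes. *)
Lemma raw_relators_typed :
  exists R : seq (seq (signed 'I_n)), map (map (@enc_signed n)) R = raw_relators.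
Proof.
rewrite /raw_relators /terminal_words.
have : forall v, v \in [seq v <- raw_levels stable_level |
      all (fun c : letter => c.1 == 0) v] -> exists w : seq (signed 'I_n), map (@enc_signed n) w = map snd v.
  move=> v; rewrite mem_filter => /andP[v0 vl].
  have [_ [u [_ vu]]] := raw_levels_sound vl; subst v.
  have [u' ->] := terminal_raw v0; exists u'.
  by rewrite /raw_word -!map_comp.
elim: (filter _ _) => [|v s IHs] vs; first by exists [::].
have [|R RE] := IHs; first by move=> u us; apply: vs; rewrite inE us orbT.
have [w wE] := vs v (mem_head _ _).
by exists (w :: R); rewrite /= wE RE.
Qed.

Definition relators : seq (seq (signed 'I_n)) := sval (cid raw_relators_typed).

Lemma relatorsE : map (map (@enc_signed n)) relators = raw_relators.
Proof. exact: svalP (cid raw_relators_typed). Qed.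

Lemma mem_relators (w : seq (signed 'I_n)) :
  (w \in relators) = (raw_word (map inl w) \in raw_levels stable_level).
Proof.
rewrite -raw_relatorsP -relatorsE mem_map //.
exact/inj_map/enc_signed_inj.
Qed.

End Raw.

Lemma algorithmic_relators : algorithmic relators.
Proof.
(* This list has the same code as [P], so that the components of [P] are read off with [nth]. *)
pose header (P : edt0l_presentation) : seq nat :=
  [:: pres_rank P; pres_extra P;
      enc_seq (@enc_letter _ _) (edt0l_axiom (pres_system P));
      enc_seq (@enc_endo _ _) (edt0l_endos (pres_system P))].
have cheader : computable header.
  by apply: computable_recode (computable_id) => P.
have caxiom : computable raw_axiom.
  apply: (computable_recode (f := fun P => nth 0 (header P) 2)).
    by move=> P; rewrite enc_raw_word.
  by computability.
have cendos : computable raw_endos.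
  apply: (computable_recode (f := fun P => nth 0 (header P) 3)).
    by move=> P; rewrite enc_raw_endos.
  by computability.
have caccepts : computable (fun x : edt0l_presentation * nat => accepts x.1 x.2).
  rewrite /accepts /raw_levels.
  by apply: computable_certifies; [| apply: computable_next_level |];
    computability; rewrite ?/raw_levels; try apply: computable_levels;
    computability; apply: computable_decode_certs; computability.
have csearch := computable_search (fun P => accepts_exists P) caccepts.
have [p Hp] : computable raw_relators.
  apply: computable_terminal_words; apply: computable_levels => //.
  apply: computable_size; apply: computable_head.
  exact: computable_decode_certs.
exists p => P; have := Hp P; rewrite -relatorsE; congr (computes _ _ _).
rewrite /enc /= /enc_relators /enc_seq -map_comp; congr CodeSeq.code.
by apply: eq_map => w /=; rewrite map_id.
Qed.

(** * Correctness of the output *)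

Section Correctness.
Variable P : edt0l_presentation.
Local Notation n := (pres_rank P).
Local Notation m := (pres_extra P).
Local Notation B := (signed 'I_n + 'I_m)%type.
Local Notation D := (pres_system P).
Local Notation W := (raw_levels P (stable_level P)).
Local Open Scope ring_scope.
Implicit Types (mu : B -> 'M[int]_2) (w : seq B).

Definition word_entry mu w : int := (\prod_(b <- w) mu b) 1 0.

Lemma word_entry_val mu : exists g, forall w,
  natpoly_val g (word_poly (raw_word w)) = word_entry mu w.
Proof.
(* Division by 4 recovers the code of the letter, and the remainder 2i + j the position of the
   entry; numbers attached to no letter get the value 0. *)
pose g (v : nat) : int :=
  if [pick b : B | enc_letter b == v %/ 4]%N is Some b
  then mu b (inord ((v %% 4) %/ 2)) (inord ((v %% 4) %% 2)) else 0.
exists g => w; rewrite natpoly_val_word /word_entry /raw_word big_map.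
congr (fun_of_matrix _ 1 0); apply: eq_bigr => b _.
apply/matrixP => i j; rewrite mxE /g /var enc_raw_letter.
have [i2 j2] := (ltn_ord i, ltn_ord j).
have ij4 : (2 * i + j < 4)%N by lia.
rewrite divnMDl // divn_small // addn0 modnMDl modn_small //.
case: pickP => [c /eqP|/(_ b)]; last by rewrite eqxx.
rewrite -!enc_raw_letter => /enc_raw_letter_inj ->.
by congr (mu b _ _); apply: val_inj; rewrite /= inordK; lia.
Qed.

Definition zero mu := forall w, raw_word w \in W -> word_entry mu w = 0.

Lemma word_entry_endo mu (phi : word_endo B) w :
  word_entry mu (endo_app phi w) =
  word_entry (fun b => \prod_(c <- phi b) mu c) w.
Proof. by rewrite /word_entry /endo_app big_flatten big_map. Qed.

(** A certificate for the image of a word under [phi] equates its polynomial, up to combinations of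
    polynomials of words in [W], with another such combination; these vanish at [mu]. *)
Lemma zero_endo mu (phi : word_endo B) : phi \in edt0l_endos D ->
  zero mu -> zero (fun b => \prod_(c <- phi b) mu c).
Proof.
move=> phiD mu0 w wW; rewrite -word_entry_endo.
have [g gE] := word_entry_val mu.
have comb0 C : natpoly_val g (combination W C) = 0.
  rewrite natpoly_val_combination big1_seq // => t _.
  have [lt|le] := ltnP (head 0%N t) (size W); last first.
    by rewrite nth_default // [natpoly_val _ _]big_nil mulr0.
  have := mem_nth [::] lt; move: (nth _ _ _) => v vW.
  have [_ [u [_ vu]]] := raw_levels_sound vW.
  by rewrite vu gE mu0 ?mulr0 // -vu.
have [certs /certifiesP/(_ (raw_word (endo_app phi w)))] := stable_levelP P.
case=> [|N [C [_ _ /(natpoly_eq_val g)]]].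
  by apply/next_levelP; exists phi, (raw_word w); rewrite subst_raw.
by rewrite natpoly_val_cat !comb0 addr0 gE.
Qed.

(** Induction on the endomorphisms, for all points at once: the outermost one is transferred from
    the word to the point, which stays in the zero set. The axiom belongs to every level. *)
Lemma zero_iter mu k w : zero mu -> edt0l_iter D k w -> word_entry mu w = 0.
Proof.
move=> mu0 [phis [_ phisD ->]] {w k}.
elim: phis mu mu0 phisD => [|phi phis IH] mu mu0 phisD.
  apply: mu0; have : raw_word (edt0l_axiom D) \in raw_levels P 0 by rewrite inE.
  elim: (stable_level P) => // k IHk /IHk.
  by rewrite raw_levelsS mem_cat => ->.
rewrite /= word_entry_endo; apply: IH => [|psi psiD].
  by apply: zero_endo => //; apply: phisD; rewrite mem_head.
by apply: phisD; rewrite inE psiD orbT.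
Qed.

(** Relators are derived terminal words, which gives one direction. For the other, a word of the
    language not killed by [f] is separated by some [p], and the resulting point contradicts
    [zero_iter]. *)
Lemma relators_kill (X : choiceType)
    (f : UMagmaMorphism.type (Defs.free 'I_n) (Defs.free X)) :
  (forall w : seq (signed 'I_n), w \in relators P ->
    f (word_val (@free_gen 'I_n) w) = 1%g) <->
  (forall w : seq (signed 'I_n), edt0l_language D w ->
    f (word_val (@free_gen 'I_n) w) = 1%g).
Proof.
split=> fR w; last first.
  rewrite mem_relators => /raw_levels_sound[k [u [uk /raw_word_inj wu]]].
  by apply: fR; exists k; rewrite wu.
move=> [k wk]; apply: contrapT => /word_mx_separates[p].
pose mu (b : B) := if b is inl a
  then word_mx p (free_word
    (f (if a.2 then (free_gen a.1)^-1 else free_gen a.1)%g))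
  else 0.
have muE (v : seq (signed 'I_n)) : \prod_(b <- map inl v) mu b =
    word_mx p (free_word (f (word_val (@free_gen 'I_n) v))).
  rewrite big_map; elim: v => [|a v IHv].
    by rewrite big_nil /word_val big_nil gmulf1 /word_mx big_nil.
  by rewrite big_cons IHv /word_val big_cons gmulfM word_mxM.
rewrite -muE -[_ 1 0]/(word_entry mu _) (zero_iter _ wk) ?eqxx // => u uW.
(* The point lies in the zero set: a nonterminal makes the product zero, while a terminal word in
   [W] is a relator, whose product is the identity matrix. *)
have [/hasP[b bu b0]|/hasPn uA] :=
  boolP (has (fun b => if b is inr _ then true else false) u).
  rewrite /word_entry (_ : \prod_(c <- u) mu c = 0) ?mxE //.
  case/splitPr: bu => u1 u2; rewrite big_cat big_cons.
  by case: b b0 => // j _; rewrite -[LHS]/(_ * (0 * _)) mul0r mulr0.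
have [u' uu'] : exists u' : seq (signed 'I_n), u = map inl u'.
  elim: u uA {uW} => [|b u IHu] uA; first by exists [::].
  have [|u' ->] := IHu; first by move=> c cu; apply: uA; rewrite inE cu orbT.
  by case: b uA => [a _|j /(_ _ (mem_head _ _))] //; exists (a :: u').
have /fR fu : u' \in relators P by rewrite mem_relators -uu'.
by rewrite /word_entry uu' muE fu /word_mx big_nil mxE.
Qed.

End Correctness.


Theorem theorem4 :
  exists R : forall P : edt0l_presentation, seq (seq (signed 'I_(pres_rank P))),
    algorithmic R /\
    forall P : edt0l_presentation,
      marked_eq
        (residually_free_image (presented [set w | w \in R P]%classic))
        (residually_free_image (pres_marked_group P)).
Proof.
exists relators; split; first exact: algorithmic_relators.
by move=> P; apply: marked_eq_residually_free => X f; apply: relators_kill.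
Qed.
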